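(* Let $n\ge1$ and $A'_{2n}=A_{2n}/\langle\omega\rangle$. For each $k\ge 2$ the action of $W_{2n}$ on $B_k(A_{2n})$, restricted to $H_{2n}$, descends along the natural surjection $B_k(A_{2n})\to B_k(A'_{2n})$ to an action of $H_{2n}$ on $B_k(A'_{2n})$; likewise, for each $k\ge1$, the action of $W_{2n}$ on $N_k(A_{2n})$, restricted to $H_{2n}$, descends along the natural surjection $N_k(A_{2n})\to N_k(A'_{2n})$ to an action of $H_{2n}$ on $N_k(A'_{2n})$.
   Context: All algebras are over $\mathbb{C}$. For an associative algebra $A$: $L_1(A)=A$, $L_k(A)=[A,L_{k-1}(A)]$ (linear span of commutators), $M_k(A)$ is the two-sided ideal generated by $L_k(A)$, $B_k(A)=L_k(A)/L_{k+1}(A)$, $N_k(A)=M_k(A)/M_{k+1}(A)$. $A_{2n}$ is the free associative algebra on $x_1,\dots,x_{2n}$, $\omega=\frac12\sum_{i=1}^n[x_i,x_{i+n}]\in A_{2n}$, and $\langle\omega\rangle$ is the two-sided ideal it generates. Let $\Omega^{even}_*(\mathbb{C}^{2n})$ be the algebra of even polynomial differential forms with Fedosov product $a*b=ab+da\wedge db$. The Feigin–Shoikhet isomorphism $A_{2n}/M_3(A_{2n})\cong\Omega^{even}_*(\mathbb{C}^{2n})$ is the algebra isomorphism with $x_i\mapsto x_i$; it sends $\omega$ to the standard symplectic form $\sum_i dx_i\wedge dx_{i+n}$, also denoted $\omega$. $W_{2n}=\mathrm{Der}\,\mathbb{C}[x_1,\dots,x_{2n}]$ is the Lie algebra of polynomial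 vector fields. It acts on $B_k(A_{2n})$ ($k\ge2$) and $N_k(A_{2n})$ ($k\ge 1$): $\sum_i f_i\partial_i$ acts through any derivation of $A_{2n}$ sending each $x_i$ to an element whose image in $A_{2n}/M_3\cong\Omega^{even}_*$ is the function $f_i$ (a known fact: the resulting operator is independent of the choice of lift and gives a Lie algebra action). $H_{2n}\subset W_{2n}$ is the Lie subalgebra of Hamiltonian vector fields, i.e. those whose Lie derivative kills the symplectic form $\omega$. *)

(* Defs.v *)
From HB Require Import structures.
From mathcomp Require Import all_boot all_order all_algebra.
From mathcomp Require classical_sets.
From mathcomp Require Import boolp functions reals complex.
From mathcomp Require Import finmap mpoly monalg.

Set Implicit Arguments.
Unset Strict Implicit.
Unset Printing Implicit Defensive.

Import GRing.Theory.
Local Open Scope ring_scope.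
Local Open Scope quotient_scope.

Record lsubspace (F : fieldType) (V : lmodType F) := LSubspace {
  lsub_pred :> {pred V};
  lsub_closed : submod_closed lsub_pred
}.

HB.instance Definition _ (F : fieldType) (V : lmodType F) (W : lsubspace V) :=
  GRing.isSubmodClosed.Build F V (lsub_pred W) (lsub_closed W).

Section LinearSpan.
Variables (F : fieldType) (V : lmodType F).

Inductive in_span (S : V -> Prop) : V -> Prop :=
  | in_span0 : in_span S 0
  | in_spanD a x u : S x -> in_span S u -> in_span S (a *: x + u).

Fact lspan_submod_closed S : submod_closed (fun v => `[< in_span S v >]).
Proof.
split; first by apply/asboolP; apply: in_span0.
move=> a u v /asboolP Su /asboolP Sv; apply/asboolP.
elim: Su => [|b x w Sx _ IH]; first by rewrite scaler0 add0r.
by rewrite scalerDr scalerA -addrA; apply: in_spanD.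
Qed.
Definition lspan S : lsubspace V := LSubspace (lspan_submod_closed S).

Lemma lspanP S v : reflect (in_span S v) (v \in lspan S).
Proof. exact: asboolP. Qed.

Lemma mem_lspan (S : V -> Prop) x : S x -> x \in lspan S.
Proof.
move=> Sx; apply/lspanP; rewrite -[x]addr0 -[x in x + 0]scale1r.
by apply: in_spanD => //; apply: in_span0.
Qed.

Lemma lspan_min (S : V -> Prop) (U : lsubspace V) :
  (forall x, S x -> x \in U) -> forall v, v \in lspan S -> v \in U.
Proof.
move=> SU v /lspanP; elim=> [|a x u Sx _ Uu]; first exact: rpred0.
by apply: rpredD => //; apply: rpredZ; exact: SU.
Qed.

End LinearSpan.

Lemma lspan_homo (F : fieldType) (V V' : lmodType F) (S : V -> Prop)
    (U : lsubspace V') (f : V -> V') :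
  linear f -> (forall x, S x -> f x \in U) ->
  forall v, v \in lspan S -> f v \in U.
Proof.
move=> lf SU v /lspanP; elim=> [|a x u Sx _ Uu].
  have := lf (- 1) 0 0; rewrite scaler0 addr0 scaleN1r addNr.
  by move=> ->; exact: rpred0.
by rewrite lf; apply: rpredD => //; apply: rpredZ; exact: SU.
Qed.

Fact fullsub_submod_closed (F : fieldType) (V : lmodType F) :
  submod_closed (predT : V -> bool).
Proof. by split. Qed.
Definition fullsub (F : fieldType) (V : lmodType F) : lsubspace V :=
  LSubspace (fullsub_submod_closed V).

Section QuotientModule.
Variables (F : fieldType) (V : lmodType F) (W : lsubspace V).

Definition quot_mod := {ideal_quot (lsub_pred W)}.
HB.instance Definition _ := Choice.on quot_mod.
HB.instance Definition _ := GRing.Zmodule.on quot_mod.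

Definition qcls (x : V) : quot_mod := \pi_({ideal_quot (lsub_pred W)}) x.
Definition qrep (y : quot_mod) : V := repr (y : {ideal_quot (lsub_pred W)}).

Lemma qrepK y : qcls (qrep y) = y. Proof. exact: reprK. Qed.

Lemma qcls_eq x y : qcls x = qcls y <-> x - y \in W.
Proof.
by rewrite Quotient.idealrBE; split=> [h|/eqP h]; [apply/eqP | ].
Qed.

Lemma qclsD x y : qcls (x + y) = qcls x + qcls y.
Proof. exact: raddfD. Qed.

Definition qscale (a : F) (y : quot_mod) : quot_mod := qcls (a *: qrep y).

Lemma qscale_cls a x : qscale a (qcls x) = qcls (a *: x).
Proof. by apply/qcls_eq; rewrite -scalerBr rpredZ //; apply/qcls_eq/qrepK. Qed.

Fact qscaleA a b y : qscale a (qscale b y) = qscale (a * b) y.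
Proof. by rewrite -[y]qrepK !qscale_cls scalerA. Qed.
Fact qscale1 : left_id 1 qscale.
Proof. by move=> y; rewrite -[y]qrepK qscale_cls scale1r. Qed.
Fact qscaleDr : right_distributive qscale +%R.
Proof.
by move=> a x y; rewrite -[x]qrepK -[y]qrepK -qclsD !qscale_cls -qclsD scalerDr.
Qed.
Fact qscaleDl y : {morph qscale^~ y : a b / a + b}.
Proof. by move=> a b; rewrite -[y]qrepK !qscale_cls -qclsD scalerDl. Qed.

HB.instance Definition _ := GRing.Zmodule_isLmodule.Build F quot_mod
  qscaleA qscale1 qscaleDr qscaleDl.

Lemma qcls_linear : linear qcls.
Proof. by move=> a x y; rewrite qclsD -qscale_cls. Qed.

End QuotientModule.

Record proper_ideal (F : fieldType) (A : algType F) := ProperIdeal {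
  ideal_sub :> lsubspace A;
  ideal_proper : 1 \notin ideal_sub;
  ideal_mull : forall a x, x \in ideal_sub -> a * x \in ideal_sub;
  ideal_mulr : forall a x, x \in ideal_sub -> x * a \in ideal_sub
}.

Section QuotientAlgebra.
Variables (F : fieldType) (A : algType F) (I : proper_ideal A).

Definition quot_alg := quot_mod I.
HB.instance Definition _ := Choice.on quot_alg.
HB.instance Definition _ := GRing.Lmodule.on quot_alg.

Definition acls (a : A) : quot_alg := qcls I a.

Definition amul (x y : quot_alg) : quot_alg := acls (qrep x * qrep y).

Lemma amul_cls a b : amul (acls a) (acls b) = acls (a * b).
Proof.
have ra c : qrep (acls c) - c \in I by apply/qcls_eq/qrepK.
apply/qcls_eq; set a' := qrep _; set b' := qrep _.
have -> : a' * b' - a * b = (a' - a) * b' + a * (b' - b).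
  by rewrite mulrBl mulrBr addrA subrK.
by apply: rpredD; [apply: ideal_mulr | apply: ideal_mull]; exact: ra.
Qed.

Lemma acls_linear : linear acls. Proof. exact: qcls_linear. Qed.
Lemma aclsD a b : acls (a + b) = acls a + acls b. Proof. exact: qclsD. Qed.
Lemma aclsK (x : quot_alg) : acls (qrep x) = x. Proof. exact: qrepK. Qed.

Fact amulA : associative amul.
Proof.
by move=> x y z; rewrite -[x]aclsK -[y]aclsK -[z]aclsK !amul_cls mulrA.
Qed.
Fact amul1r : left_id (acls 1) amul.
Proof. by move=> x; rewrite -[x]aclsK amul_cls mul1r. Qed.
Fact amulr1 : right_id (acls 1) amul.
Proof. by move=> x; rewrite -[x]aclsK amul_cls mulr1. Qed.
Fact amulDl : left_distributive amul +%R.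
Proof.
move=> x y z; rewrite -[x]aclsK -[y]aclsK -[z]aclsK.
by rewrite -aclsD !amul_cls -aclsD mulrDl.
Qed.
Fact amulDr : right_distributive amul +%R.
Proof.
move=> x y z; rewrite -[x]aclsK -[y]aclsK -[z]aclsK.
by rewrite -aclsD !amul_cls -aclsD mulrDr.
Qed.
Fact aone_neq0 : acls 1 != 0.
Proof.
have -> : 0 = acls 0 by apply: (addrI (acls 0)); rewrite -aclsD !addr0.
by apply/eqP => /qcls_eq; rewrite subr0; apply/negP/ideal_proper.
Qed.

HB.instance Definition _ := GRing.Zmodule_isNzRing.Build quot_alg
  amulA amul1r amulr1 amulDl amulDr aone_neq0.

Lemma aclsM a b : acls (a * b) = acls a * acls b.
Proof. by rewrite -amul_cls. Qed.

Fact ascaleAl (a : F) (x y : quot_alg) : a *: (x * y) = a *: x * y.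
Proof.
have Z b : a *: acls b = acls (a *: b) by exact: qscale_cls.
by rewrite -[x]aclsK -[y]aclsK Z -!aclsM Z scalerAl.
Qed.
HB.instance Definition _ := GRing.Lmodule_isLalgebra.Build F quot_alg ascaleAl.
Fact ascaleAr (a : F) (x y : quot_alg) : a *: (x * y) = x * (a *: y).
Proof.
have Z b : a *: acls b = acls (a *: b) by exact: qscale_cls.
by rewrite -[x]aclsK -[y]aclsK Z -!aclsM Z scalerAr.
Qed.
HB.instance Definition _ := GRing.Lalgebra_isAlgebra.Build F quot_alg ascaleAr.

End QuotientAlgebra.

(* [subquo U W] is U / (U :&: W), used below with W contained in U *)
Section Subquotient.
Variables (F : fieldType) (V : lmodType F) (U W : lsubspace V).

Definition subsp := {x : V | x \in U}.
HB.instance Definition _ := SubChoice.on subsp.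
HB.instance Definition _ := [SubChoice_isSubLmodule of subsp by <:].

Fact restr_submod_closed : submod_closed (fun x : subsp => val x \in W).
Proof.
split=> [|a x y].
  by rewrite -topredE /= rpred0.
rewrite -!topredE /= => Wx Wy; apply: rpredD => //; exact: rpredZ.
Qed.
Definition restr : lsubspace subsp := LSubspace restr_submod_closed.

Definition subquo := quot_mod restr.
HB.instance Definition _ := Choice.on subquo.
HB.instance Definition _ := GRing.Lmodule.on subquo.

Definition subcls (x : V) (Ux : x \in U) : subquo :=
  qcls restr (exist _ x Ux).

Definition subrep (y : subquo) : V := val (qrep y).

Lemma subrepP y : subrep y \in U. Proof. exact: valP. Qed.

Lemma subrepK y : subcls (subrepP y) = y.
Proof.
rewrite -[RHS]qrepK /subcls; congr (qcls _ _).
exact/val_inj.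
Qed.

Lemma subcls_eq x y (Ux : x \in U) (Uy : y \in U) :
  subcls Ux = subcls Uy <-> x - y \in W.
Proof. by rewrite /subcls qcls_eq unfold_in /restr raddfB. Qed.

Lemma subrep_cls x (Ux : x \in U) : subrep (subcls Ux) - x \in W.
Proof. by apply/(subcls_eq (subrepP _) Ux); rewrite subrepK. Qed.

End Subquotient.

(* The map U/W -> U'/W' induced by f; it is meaningful when f is linear and
   sends W into W' (lemma subquo_mapE). *)
Definition subquo_map (F : fieldType) (V V' : lmodType F)
    (U W : lsubspace V) (U' W' : lsubspace V') (f : V -> V')
    (fU : forall x, x \in U -> f x \in U') (y : subquo U W) : subquo U' W' :=
  subcls W' (fU _ (subrepP y)).

Lemma subquo_mapE (F : fieldType) (V V' : lmodType F)
    (U W : lsubspace V) (U' W' : lsubspace V') (f : V -> V')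
    (fU : forall x, x \in U -> f x \in U') :
  linear f -> (forall x, x \in W -> f x \in W') ->
  forall x (Ux : x \in U),
    subquo_map W' fU (subcls W Ux) = subcls W' (fU x Ux).
Proof.
move=> lf fW x Ux; apply/subcls_eq.
have -> : f (subrep (subcls W Ux)) - f x = f (subrep (subcls W Ux) - x).
  by rewrite addrC [_ - x]addrC -scaleN1r -lf scaleN1r.
exact/fW/subrep_cls.
Qed.

Lemma subquo_map_surj (F : fieldType) (V V' : lmodType F)
    (U W : lsubspace V) (U' W' : lsubspace V') (f : V -> V')
    (fU : forall x, x \in U -> f x \in U') :
  linear f -> (forall x, x \in W -> f x \in W') ->
  (forall y, y \in U' -> exists2 x, x \in U & y = f x) ->
  forall z : subquo U' W', exists y : subquo U W, subquo_map W' fU y = z.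
Proof.
move=> lf fW fS z; have [x Ux zE] := fS _ (subrepP z).
exists (subcls W Ux); rewrite subquo_mapE // -[RHS]subrepK.
by apply/subcls_eq; rewrite zE subrr rpred0.
Qed.

Lemma lspan_lift (F : fieldType) (V V' : lmodType F) (U : lsubspace V)
    (S : V' -> Prop) (f : V -> V') :
  linear f -> (forall y, S y -> exists2 x, x \in U & y = f x) ->
  forall y, y \in lspan S -> exists2 x, x \in U & y = f x.
Proof.
move=> lf fS y /lspanP; elim=> [|a z u /fS[x Ux ->] _ [x' Ux' ->]].
  exists 0; first exact: rpred0.
  have := lf (- 1) 0 0; rewrite scaler0 addr0 scaleN1r addNr => ->; by [].
by exists (a *: x + x'); rewrite ?lf // rpredD // rpredZ.
Qed.

Section LowerCentral.
Variables (F : fieldType) (A : algType F).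

Definition comm (a b : A) : A := a * b - b * a.

(* The index k is used for k >= 1 only; L_0 is set to A by convention *)
Fixpoint Lser (k : nat) : lsubspace A :=
  if k is j.+1 then
    if j is 0 then fullsub A
    else lspan (fun x => exists a b, b \in Lser j /\ x = comm a b)
  else fullsub A.

Definition ideal_gen (S : A -> Prop) : lsubspace A :=
  lspan (fun x => exists a s b, S s /\ x = a * s * b).

Definition Mser (k : nat) : lsubspace A := ideal_gen (fun x => x \in Lser k).

Definition Bquo k := subquo (Lser k) (Lser k.+1).
HB.instance Definition _ k := GRing.Lmodule.on (Bquo k).

Definition Nquo k := subquo (Mser k) (Mser k.+1).
HB.instance Definition _ k := GRing.Lmodule.on (Nquo k).

Lemma ideal_gen_mull S a x : x \in ideal_gen S -> a * x \in ideal_gen S.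
Proof.
apply: (lspan_homo (f := fun x => a * x)) => [c u v|y [b [s [c [Ss ->]]]]].
  by rewrite mulrDr scalerAr.
by apply: mem_lspan; exists (a * b), s, c; rewrite !mulrA.
Qed.

Lemma ideal_gen_mulr S a x : x \in ideal_gen S -> x * a \in ideal_gen S.
Proof.
apply: (lspan_homo (f := fun x => x * a)) => [c u v|y [b [s [c [Ss ->]]]]].
  by rewrite mulrDl scalerAl.
by apply: mem_lspan; exists b, s, (c * a); rewrite !mulrA.
Qed.

End LowerCentral.
Arguments Lser {F} A k.
Arguments Mser {F} A k.
Arguments Bquo {F} A k.
Arguments Nquo {F} A k.

Section Functoriality.
Variables (F : fieldType) (A A' : algType F) (f : A -> A').
Hypotheses (lf : linear f) (fM : forall a b, f (a * b) = f a * f b).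

Lemma Lser_homo k x : x \in Lser A k -> f x \in Lser A' k.
Proof.
elim: k x => // -[//|k] IH; apply: lspan_homo => // x [a [b [Lb ->]]].
apply: mem_lspan; exists (f a), (f b); split; first exact: IH.
by rewrite /comm addrC -scaleN1r lf !fM scaleN1r addrC.
Qed.

Lemma Mser_homo k x : x \in Mser A k -> f x \in Mser A' k.
Proof.
apply: lspan_homo => // y [a [s [b [Ls ->]]]]; apply: mem_lspan.
by exists (f a), (f s), (f b); rewrite !fM; split=> //; apply: Lser_homo.
Qed.

Hypothesis fS : forall y, exists x, f x = y.

Lemma Lser_surj k y : y \in Lser A' k -> exists2 x, x \in Lser A k & y = f x.
Proof.
elim: k y => [|[|k] IH] y; try by move=> _; have [x <-] := fS y; exists x.
apply: lspan_lift => // _ [a [b [/IH[d Ld ->] ->]]]; have [c <-] := fS a.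
exists (comm c d); first by apply: mem_lspan; exists c, d.
by rewrite /comm -!fM addrC [_ - _ in RHS]addrC -!scaleN1r lf.
Qed.

Lemma Mser_surj k y : y \in Mser A' k -> exists2 x, x \in Mser A k & y = f x.
Proof.
apply: lspan_lift => // _ [a [s [b [/Lser_surj[t Lt ->] ->]]]].
have [c <-] := fS a; have [d <-] := fS b.
by exists (c * t * d); rewrite ?fM //; apply: mem_lspan; exists c, t, d.
Qed.

End Functoriality.

Section Derivations.
Variables (F : fieldType) (A : algType F).

Definition is_derivation (D : A -> A) : Prop :=
  linear D /\ forall a b, D (a * b) = D a * b + a * D b.

Fact derivation_submod_closed :
  submod_closed (fun D : A -> A => `[< is_derivation D >]).
Proof.
have z x : (0 : A -> A) x = 0 by [].
split.
  apply/asboolP; split=> [c x y|a b]; rewrite !z ?scaler0 ?addr0 //.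
  by rewrite mul0r mulr0 addr0.
move=> c D E /asboolP[lD DM] /asboolP[lE EM]; apply/asboolP.
have e x : (c *: D + E) x = c *: D x + E x by [].
split=> [a x y|a b]; rewrite !e.
  by rewrite lD lE !scalerDr !scalerA mulrC addrACA.
by rewrite DM EM scalerDr mulrDl mulrDr scalerAl scalerAr addrACA.
Qed.
Definition derivation : lsubspace (A -> A) :=
  LSubspace derivation_submod_closed.

Definition der := {D : A -> A | D \in derivation}.
HB.instance Definition _ := SubChoice.on der.
HB.instance Definition _ := [SubChoice_isSubLmodule of der by <:].

Definition der_fun (D : der) : A -> A := val D.

Lemma der_linear D : linear (der_fun D).
Proof. by have /asboolP[] := valP D. Qed.
Lemma derM D a b : der_fun D (a * b) = der_fun D a * b + a * der_fun D b.
Proof. by have /asboolP[_ DM] := valP D; exact: DM. Qed.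

Fact der_bracket_subproof (D E : der) :
  (fun a => der_fun D (der_fun E a) - der_fun E (der_fun D a)) \in derivation.
Proof.
apply/asboolP; split=> [c x y|a b].
  by rewrite !der_linear opprD addrACA scalerBr.
have D_add G x y : der_fun G (x + y) = der_fun G x + der_fun G y.
  by rewrite -[x]scale1r der_linear !scale1r.
rewrite !derM !D_add !derM mulrBl mulrBr.
set p := _ * b; set q := _ * _; set r := _ * _; set s := _ * _.
set p' := _ * b; set s' := a * _.
rewrite [r + s]addrC [q + s']addrC addrACA [p' + r + _]addrACA [r + q]addrC.
by rewrite opprD [LHS]addrACA subrr addr0 opprD addrACA.
Qed.
Definition der_bracket (D E : der) : der :=
  exist (fun D : A -> A => D \in derivation) _ (der_bracket_subproof D E).

Lemma der_Lser (D : der) k x : x \in Lser A k -> der_fun D x \in Lser A k.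
Proof.
elim: k x => // -[//|k] IH; apply: lspan_homo; first exact: der_linear.
move=> _ [a [b [Lb ->]]].
have -> : der_fun D (comm a b) = comm (der_fun D a) b + comm a (der_fun D b).
  rewrite /comm -[_ - _ in LHS]addrC -scaleN1r der_linear scaleN1r !derM.
  by rewrite opprD addrC [- _ - _]addrC addrACA.
apply: rpredD; apply: mem_lspan.
  by exists (der_fun D a), b.
by exists a, (der_fun D b); split=> //; apply: IH.
Qed.

Lemma der_Mser (D : der) k x : x \in Mser A k -> der_fun D x \in Mser A k.
Proof.
apply: lspan_homo => [|_ [a [s [b [Ls ->]]]]]; first exact: der_linear.
rewrite !derM mulrDl; do 2 ?apply: rpredD; apply: mem_lspan.
- by exists (der_fun D a), s, b.
- by exists a, (der_fun D s), b; split=> //; apply: der_Lser.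
- by exists a, s, (der_fun D b).
Qed.

End Derivations.

(* A Lie algebra of derivations is given as a predicate [g] on [der A]; only
   the values of [rho] on [g] matter. *)
Definition lie_action (F : fieldType) (A : algType F) (g : der A -> Prop)
    (M : lmodType F) (rho : der A -> M -> M) : Prop :=
  [/\ forall D, g D -> linear (rho D),
      forall a D E, g D -> g E ->
        forall m, rho (a *: D + E) m = a *: rho D m + rho E m &
      forall D E, g D -> g E ->
        forall m, rho (der_bracket D E) m = rho D (rho E m) - rho E (rho D m)].

Section DifferentialForms.
Variables (F : fieldType) (m : nat).
Local Notation P := {mpoly F[m]}.

(* alpha S is the coefficient of dx_{i_1} /\ ... /\ dx_{i_r}, where
   i_1 < ... < i_r are the elements of S *)
Definition form := {ffun {set 'I_m} -> P}.

Definition form0 (p : P) : form := [ffun S => if S == set0 then p else 0].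

Definition dvar (i : 'I_m) : form := [ffun S => if S == [set i] then 1 else 0].

Definition inversions (S T : {set 'I_m}) : nat :=
  #|[set p : 'I_m * 'I_m | [&& p.1 \in S, p.2 \in T & (p.2 < p.1)%N]]|.

Definition wedge (al be : form) : form :=
  [ffun S : {set 'I_m} => \sum_(T in powerset S)
     (-1) ^+ inversions T (S :\: T) * al T * be (S :\: T)].

Definition dform (al : form) : form :=
  \sum_(i < m) wedge (dvar i) [ffun S => mderiv i (al S)].

Definition contract (v : der P) (al : form) : form :=
  [ffun S : {set 'I_m} => \sum_(i | i \notin S)
     (-1) ^+ inversions [set i] S * der_fun v 'X_i * al (i |: S)].

Definition lie_derivative (v : der P) (al : form) : form :=
  dform (contract v al) + contract v (dform al).

Definition fedosov (al be : form) : form :=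
  wedge al be + wedge (dform al) (dform be).

Lemma wedge_form0 p al : wedge (form0 p) al = [ffun S => p * al S].
Proof.
apply/ffunP => S; rewrite !ffunE (bigD1 set0) ?powersetE ?sub0set //= big1.
  rewrite addr0 ffunE eqxx setD0 [inversions _ _](_ : _ = 0%N) ?mul1r //.
  by apply: eq_card0 => x; rewrite !inE.
by move=> T /andP[_ /negPf T0]; rewrite ffunE T0 mulr0 mul0r.
Qed.

Lemma dform_form0 p : dform (form0 p) =
  \sum_(i < m) wedge (dvar i) (form0 (mderiv i p)).
Proof.
apply: eq_bigr => i _; congr wedge; apply/ffunP => S; rewrite !ffunE.
by case: ifP => // _; rewrite mderiv0.
Qed.

Lemma fedosov_form01 p : fedosov (form0 p) (form0 1) = form0 p.
Proof.
have d1 : dform (form0 1) = 0.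
  rewrite dform_form0 big1 // => i _; apply/ffunP => S.
  rewrite !ffunE big1 // => T _; rewrite [form0 _ _]ffunE -mpolyC1 mderivC.
  by rewrite if_same mulr0.
rewrite /fedosov d1 wedge_form0; apply/ffunP => S; rewrite !ffunE big1.
  by rewrite addr0; case: ifP; rewrite ?mulr1 ?mulr0.
by move=> T _; rewrite ffunE mulr0.
Qed.

End DifferentialForms.

Section FreeAlgebra.
Variables (F : fieldType) (m : nat).

Definition freealg := {malg F[{fmonom 'I_m}]}.
HB.instance Definition _ := GRing.Lalgebra.on freealg.

Fact freealg_scaleAr (c : F) (a b : freealg) : c *: (a * b) = a * (c *: b).
Proof.
apply/malgP => k; rewrite monalg.mcoeffZ.
rewrite [in RHS](mcoeffMlw _ (fsubset_refl _) (msuppZ_le _ _)).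
rewrite mcoeffMl mulr_sumr; apply: eq_bigr => w _; rewrite mulr_sumr.
by apply: eq_bigr => w' _; rewrite monalg.mcoeffZ mulrnAr mulrCA.
Qed.
HB.instance Definition _ :=
  GRing.Lalgebra_isAlgebra.Build F freealg freealg_scaleAr.

Definition gen (i : 'I_m) : freealg := << fmu i >>.

(* The algebra morphism from the free algebra to even forms with the Fedosov
   product that sends gen i to the function x_i, i.e. the composite
   A -> A / M_3(A) ~ Omega^even_*.  It is defined on words by
   x_{i_1} * (x_{i_2} * ( ... * 1)). *)
Definition fs_word (w : {fmonom 'I_m}) : form F m :=
  foldr (fun i al => fedosov (form0 'X_i) al) (form0 1) w.

Definition feigin_shoikhet (a : freealg) : form F m :=
  \sum_(w <- monalg.msupp a) monalg.mcoeff w a *: fs_word w.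

Lemma feigin_shoikhet_gen i : feigin_shoikhet (gen i) = form0 'X_i.
Proof.
rewrite /feigin_shoikhet /gen msuppU oner_eq0 big_seq_fset1 mcoeffUU scale1r.
by rewrite /fs_word fmuE /= fedosov_form01.
Qed.

Definition lifts (v : der {mpoly F[m]}) (D : der freealg) : Prop :=
  forall i, feigin_shoikhet (der_fun D (gen i)) = form0 (der_fun v 'X_i).

Definition lift_der (v : der {mpoly F[m]}) : der freealg :=
  classical_sets.xget 0 (lifts v).

(* The operators are independent of the choice of lift made in [lift_der] for
   k >= 2, resp. k >= 1. *)
Definition actB k (v : der {mpoly F[m]}) : Bquo freealg k -> Bquo freealg k :=
  subquo_map (Lser freealg k.+1) (@der_Lser _ _ (lift_der v) k).

Definition actN k (v : der {mpoly F[m]}) : Nquo freealg k -> Nquo freealg k :=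
  subquo_map (Mser freealg k.+1) (@der_Mser _ _ (lift_der v) k).

Lemma actB_cls k v x (Lx : x \in Lser freealg k) :
  actB v (subcls _ Lx) = subcls _ (der_Lser (lift_der v) Lx).
Proof. by apply: subquo_mapE; [exact: der_linear | exact: der_Lser]. Qed.

Lemma actN_cls k v x (Mx : x \in Mser freealg k) :
  actN v (subcls _ Mx) = subcls _ (der_Mser (lift_der v) Mx).
Proof. by apply: subquo_mapE; [exact: der_linear | exact: der_Mser]. Qed.

End FreeAlgebra.

Section Symplectic.
Variables (F : fieldType) (n : nat).
Local Notation A := (freealg F (n + n)).

Definition omega : A :=
  2^-1 *: \sum_(i < n) comm (gen F (lshift n i)) (gen F (rshift n i)).

Definition omega_form : form F (n + n) :=
  \sum_(i < n) wedge (dvar F (lshift n i)) (dvar F (rshift n i)).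

Definition hamiltonian (v : der {mpoly F[n + n]}) : Prop :=
  lie_derivative v omega_form = 0.

Definition omega_sub : lsubspace A := ideal_gen (fun x => x = omega).

Fact omega_proper : 1 \notin omega_sub.
Proof.
pose e (a : {malg F[{fmonom 'I_(n + n)}]}) :=
  monalg.mcoeff (@monalg.one {fmonom _}) a.
have eM a b : e (a * b) = e a * e b by exact: rmorphM.
have eB a b : e (a - b) = e a - e b by exact: raddfB.
have eO : e omega = 0.
  rewrite /e /omega monalg.mcoeffZ raddf_sum big1 ?mulr0 // => i _.
  by rewrite [LHS]eB !eM mulrC subrr.
apply/negP => /lspanP h.
suff : e 1 = 0 by rewrite /e mcoeff1 eqxx => /eqP; rewrite oner_eq0.
elim: h => [|c x u [a [s [b [-> ->]]]] _ eu]; first exact: raddf0.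
have eP y v : e (c *: y + v) = c * e y + e v.
  by rewrite /e monalg.mcoeffD monalg.mcoeffZ.
by rewrite [LHS]eP eu addr0 (eM _ b) (eM a) eO mulr0 mul0r mulr0.
Qed.
Definition omega_ideal : proper_ideal A :=
  @ProperIdeal _ _ omega_sub omega_proper
    (@ideal_gen_mull _ _ _) (@ideal_gen_mulr _ _ _).

Definition freealg_omega := quot_alg omega_ideal.
HB.instance Definition _ := GRing.Algebra.on freealg_omega.

Definition projA : A -> freealg_omega := acls omega_ideal.

Fact projA_linear : linear projA. Proof. exact: acls_linear. Qed.
Fact projAM a b : projA (a * b) = projA a * projA b.
Proof. exact: aclsM. Qed.
Fact projA_surj y : exists x, projA x = y.
Proof. by exists (qrep y); exact: qrepK. Qed.

Definition projB k : Bquo A k -> Bquo freealg_omega k :=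
  subquo_map (Lser freealg_omega k.+1) (Lser_homo projA_linear projAM (k := k)).

Definition projN k : Nquo A k -> Nquo freealg_omega k :=
  subquo_map (Mser freealg_omega k.+1) (Mser_homo projA_linear projAM (k := k)).

Lemma projB_cls k x (Lx : x \in Lser A k) :
  projB (subcls _ Lx) = subcls _ (Lser_homo projA_linear projAM Lx).
Proof.
apply: subquo_mapE => [|y]; first exact: projA_linear.
exact: (Lser_homo projA_linear projAM).
Qed.

Lemma projN_cls k x (Mx : x \in Mser A k) :
  projN (subcls _ Mx) = subcls _ (Mser_homo projA_linear projAM Mx).
Proof.
apply: subquo_mapE => [|y]; first exact: projA_linear.
exact: (Mser_homo projA_linear projAM).
Qed.

Lemma projB_surj k (z : Bquo freealg_omega k) : exists y, projB y = z.
Proof.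
apply: subquo_map_surj; first exact: projA_linear.
  by move=> y; exact: (Lser_homo projA_linear projAM).
by move=> y; exact: (Lser_surj projA_linear projAM projA_surj).
Qed.

Lemma projN_surj k (z : Nquo freealg_omega k) : exists y, projN y = z.
Proof.
apply: subquo_map_surj; first exact: projA_linear.
  by move=> y; exact: (Mser_homo projA_linear projAM).
by move=> y; exact: (Mser_surj projA_linear projAM projA_surj).
Qed.

End Symplectic.

(* Main.v *)
(* Put B = A / M_3.  Double commutators vanish in B, so the Jordan product
   (a b + b a) / 2 makes B a commutative associative algebra and x_i |-> x_i
   extends to an algebra morphism sym from polynomials to B.  Together with
   dx_i /\ dx_j |-> [x_i, x_j] / 2 it gives a left inverse, modulo M_3, of the
   Feigin-Shoikhet map, whose kernel is therefore contained in M_3.  A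
   derivation with values in M_3 maps L_k to L_(k+1) for k >= 2 and M_k to
   M_(k+1), because [M_3, L_k] is in L_(k+2) and M_3 L_k in M_(k+1); hence the
   operators do not depend on the lifts.  They are compatible with brackets
   because a lift D of v induces a derivation of the Jordan algebra B, so that
   D (sym p) = sym (v p).

   A Hamiltonian field is the field of some potential h by the Poincare lemma,
   and h is a linear combination of powers of linear forms.  For h = l^k the
   derivation sending each generator to the corresponding multiple of l^(k-1)
   is a lift, and it kills omega since [l^(k-1), l] = 0.  The action can thus be
   computed with lifts that preserve the ideal of omega. *)
From HB Require Import structures.
Require Import Defs.
From mathcomp Require Import all_boot all_order all_algebra.
From mathcomp Require Import boolp functions reals complex.
From mathcomp Require Import finmap mpoly.
From mathcomp Require monalg.

Set Implicit Arguments.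
Unset Strict Implicit.
Unset Printing Implicit Defensive.

Import GRing.Theory.
Local Open Scope ring_scope.

(** * Identities in non-commutative rings *)

Lemma addl_eq0 (V : zmodType) (s t : V) : s = - t -> s + t = 0.
Proof. by move=> ->; rewrite addNr. Qed.

Lemma addl_id (V : zmodType) (s t : V) : s = 0 -> s + t = t.
Proof. by move=> ->; rewrite add0r. Qed.

(* Proves identities of non-commutative rings: both sides are expanded into
   signed monomials, which are then cancelled in pairs. *)
Ltac rotate_sum :=
  lazymatch goal with
  | |- ?s + ?t = ?u => tryif unify t u then fail else rewrite [LHS]addrC ?addrA
  end.

(** The last term moves to the right-hand side, the remaining sum is rotated until its last term
    agrees with it, and the two cancel; 30 bounds the number of rotations. *)
Ltac cancel_sum :=
  rewrite ?opprK;
  first [ done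
        | apply: addl_eq0; rewrite ?opprK; do 30 ?rotate_sum;
          first [done | apply: addl_id; cancel_sum] ].

Ltac nc_ring :=
  apply/eqP; rewrite -subr_eq0; apply/eqP;
  rewrite ?(mulrDl, mulrDr, mulNr, mulrN, opprD, opprK, mulrA, addrA);
  cancel_sum.

(** * Commutator inclusions for L_k and M_k, and derivations with values in M_3 *)

Section LowerCentralSeries.
Variables (F : fieldType) (A : algType F).
Implicit Types (a b c x y : A) (k : nat).

Lemma comm_linearr a : linear (comm a).
Proof.
move=> c x y; rewrite /comm mulrDl mulrDr -scalerAl -scalerAr scalerBr; nc_ring.
Qed.

Lemma comm_linearl b : linear (fun a : A => comm a b).
Proof.
move=> c x y; rewrite /comm mulrDl mulrDr -scalerAl -scalerAr scalerBr; nc_ring.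
Qed.

Lemma comm_jacobi a b c : comm (comm a b) c = comm a (comm b c) - comm b (comm a c).
Proof. by rewrite /comm; nc_ring. Qed.

Lemma comm_mulr a b c : comm a (b * c) = comm a b * c + b * comm a c.
Proof. by rewrite /comm; nc_ring. Qed.

Lemma comm_mull a b c : comm (a * b) c = a * comm b c + comm a c * b.
Proof. by rewrite /comm; nc_ring. Qed.

Lemma comm_anti a b : comm a b = - comm b a.
Proof. by rewrite /comm opprB. Qed.

Lemma comm_cyclic a b c : comm a (b * c) = - comm b (c * a) - comm c (a * b).
Proof. by rewrite /comm; nc_ring. Qed.

Lemma Lser_comm k a b : b \in Lser A k.+1 -> comm a b \in Lser A k.+2.
Proof. by move=> Lb; apply: mem_lspan; exists a, b. Qed.

Lemma Lser_sub k x : x \in Lser A k.+1 -> x \in Lser A k.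
Proof.
elim: k x => [//|[//|k] IH] x; apply: lspan_min => _ [a [b [Lb ->]]].
by apply: Lser_comm; apply: IH.
Qed.

(** Induction on [i]: the Jacobi identity moves one bracket from the first argument to the
    second. *)
Lemma Lser_commD i j a b :
  a \in Lser A i.+1 -> b \in Lser A j.+1 -> comm a b \in Lser A (i + j).+2.
Proof.
elim: i j a b => [|i IH] j a b; first by move=> _; apply: Lser_comm.
move=> La Lb; move: a La.
apply: (lspan_homo (f := fun a => comm a b)); first exact: comm_linearl.
move=> _ [c [a [La ->]]]; rewrite comm_jacobi rpredB //.
  by apply: Lser_comm; apply: IH.
by rewrite addSnnS; apply: IH => //; apply: Lser_comm.
Qed.

Lemma Mser_mull k a x : x \in Mser A k -> a * x \in Mser A k.
Proof. exact: ideal_gen_mull. Qed.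

Lemma Mser_mulr k a x : x \in Mser A k -> x * a \in Mser A k.
Proof. exact: ideal_gen_mulr. Qed.

Lemma Mser_comm k a x : x \in Mser A k -> comm a x \in Mser A k.
Proof. by move=> Mx; apply: rpredB; [exact: Mser_mull | exact: Mser_mulr]. Qed.

Lemma Lser_Mser k x : x \in Lser A k -> x \in Mser A k.
Proof. by move=> Lx; apply: mem_lspan; exists 1, x, 1; rewrite mul1r mulr1. Qed.

Lemma Mser_sub k x : x \in Mser A k.+1 -> x \in Mser A k.
Proof.
apply: lspan_min => _ [a [s [b [Ls ->]]]].
by apply: Mser_mulr; apply: Mser_mull; apply: Lser_Mser; apply: Lser_sub.
Qed.

(* By [comm_cyclic], since [c, d] and [a, b] commute with everything modulo
   L_3. *)
Lemma comm_mul_comm x a b c d : comm x (comm c d * comm a b) \in Lser A 3.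
Proof.
have L2 e f : comm e f \in Lser A 2 by apply: Lser_comm.
by rewrite comm_cyclic rpredB ?rpredN // comm_anti rpredN Lser_comm.
Qed.

(** Bracketing with [y] sends commutators into L_3, so the argument matters only modulo commutators.
    Modulo these, [a * s * b] may be rotated to [b * a * s], and [a * comm b (comm c d)] becomes a
    product of two commutators, to which [comm_mul_comm] applies. *)
Lemma comm_Mser3 x y : x \in Mser A 3 -> comm y x \in Lser A 3.
Proof.
apply: (lspan_homo (f := comm y)); first exact: comm_linearr.
move=> _ [a [s [b [Ls ->]]]].
have -> : a * s * b = b * a * s + comm (a * s) b.
  by rewrite /comm; nc_ring.
rewrite -[_ * s]scale1r comm_linearr scale1r rpredD //; last first.
  by apply: Lser_comm; apply: Lser_comm.
move: (b * a) => {}a; move: s Ls.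
apply: (lspan_homo (f := fun s => comm y (a * s))).
  by move=> c u v; rewrite mulrDr -scalerAr comm_linearr.
move=> _ [{}b [s [Ls ->]]]; move: s Ls.
apply: (lspan_homo (f := fun s => comm y (a * comm b s))).
  by move=> c u v; rewrite comm_linearr mulrDr -scalerAr comm_linearr.
move=> _ [c [d [_ ->]]].
have -> : a * comm b (comm c d) = comm c d * comm a b +
    (comm (a * b) (comm c d) - comm a (comm c d * b)).
  by rewrite /comm; nc_ring.
rewrite -[_ * comm a b]scale1r comm_linearr scale1r rpredD ?comm_mul_comm //.
by apply: Lser_comm; rewrite rpredB //; apply: Lser_comm.
Qed.

(** The case of L_1 is [comm_Mser3]. The Leibniz rule for [x, -] propagates the gain of two degrees:
    [x, a] lies in L_3, so [Lser_commD] handles [[x, a], b]. *)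
Lemma comm_Mser3_Lser k x y :
  x \in Mser A 3 -> y \in Lser A k.+1 -> comm x y \in Lser A k.+3.
Proof.
move=> Mx; elim: k y => [|k IH] y.
  by rewrite comm_anti rpredN => _; apply: comm_Mser3.
apply: (lspan_homo (f := comm x)) => [|_ [a [b [Lb ->]]]].
  exact: comm_linearr.
have -> : comm x (comm a b) = comm (comm x a) b + comm a (comm x b).
  by rewrite /comm; nc_ring.
rewrite rpredD //; last by apply: Lser_comm; apply: IH.
have Lxa : comm x a \in Lser A 3 by rewrite comm_anti rpredN comm_Mser3.
exact: (@Lser_commD 2 k).
Qed.

(* Write l = [p, q].  Modulo M_(k+1) the element l is central and, for u in
   L_2, l u = [p u, q]; hence l [v, u] = [v, l u] vanishes. *)
Lemma Mser3_mul_Lser k x l :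
  x \in Mser A 3 -> l \in Lser A k.+1 -> x * l \in Mser A k.+2.
Proof.
case: k => [Mx _|k Mx Ll]; first by apply: Mser_mulr; apply: Mser_sub.
move: x Mx; apply: (lspan_homo (f := fun x => x * l)) => [c u v|].
  by rewrite mulrDl scalerAl.
move=> _ [a [s [b [Ls ->]]]].
have -> : a * s * b * l = a * (s * l) * b + a * s * comm b l.
  by rewrite /comm; nc_ring.
rewrite rpredD //; last first.
  by apply: Mser_mull; apply: Lser_Mser; apply: Lser_comm.
apply: Mser_mulr; apply: Mser_mull.
have -> : s * l = l * s + comm s l by rewrite /comm; nc_ring.
have Lsl : comm s l \in Lser A k.+3.
  by do 2 apply: Lser_sub; apply: (@Lser_commD 2 k.+1).
rewrite rpredD ?(Lser_Mser Lsl) // => {a b Lsl}; move: s Ls.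
apply: (lspan_homo (f := fun s => l * s)) => [c u v|_ [v [u [Lu ->]]]].
  by rewrite mulrDr scalerAr.
move: l Ll.
apply: (lspan_homo (f := fun l => l * comm v u)) => [c d e|].
  by rewrite mulrDl scalerAl.
move=> _ [p [q [Lq ->]]].
have -> : comm p q * comm v u = comm v (comm (p * u) q) -
    comm v (p * comm u q) - comm v (comm p q) * u.
  by rewrite /comm; nc_ring.
have Luq : comm u q \in Lser A k.+3 by apply: (@Lser_commD 1 k).
apply: rpredB; first apply: rpredB.
- by apply: Lser_Mser; do 2 apply: Lser_comm.
- by apply: Mser_comm; apply: Mser_mull; apply: Lser_Mser.
- by apply: Mser_mulr; apply: Lser_Mser; do 2 apply: Lser_comm.
Qed.

Lemma der_comm (D : der A) a b :
  der_fun D (comm a b) = comm (der_fun D a) b + comm a (der_fun D b).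
Proof.
rewrite /comm -scaleN1r addrC der_linear scaleN1r !derM; nc_ring.
Qed.

Section SmallDerivation.
Variable D : der A.
Hypothesis D_Mser3 : forall a, der_fun D a \in Mser A 3.

(** At k = 2 both terms of the Leibniz rule lie in [A, M_3]. Beyond that, the term [D a, b] is
    covered by [comm_Mser3_Lser] and [a, D b] by induction. *)
Lemma small_der_Lser k x : (2 <= k)%N ->
  x \in Lser A k -> der_fun D x \in Lser A k.+1.
Proof.
case: k => [|[|k]] // _; elim: k x => [|k IH] x.
  apply: lspan_homo => [|_ [a [b [_ ->]]]]; first exact: der_linear.
  rewrite der_comm rpredD //; last exact: comm_Mser3.
  exact: (@comm_Mser3_Lser 0).
apply: lspan_homo => [|_ [a [b [Lb ->]]]]; first exact: der_linear.
rewrite der_comm rpredD //; first exact: comm_Mser3_Lser.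
by apply: Lser_comm; apply: IH.
Qed.

Lemma small_der_Mser k x : (1 <= k)%N ->
  x \in Mser A k -> der_fun D x \in Mser A k.+1.
Proof.
case: k => [|[|k]] // _; first by move=> _; apply: Mser_sub.
apply: lspan_homo => [|_ [a [s [b [Ls ->]]]]]; first exact: der_linear.
have M3s c : c \in Mser A 3 -> c * s \in Mser A k.+3.
  by move=> Mc; apply: Mser3_mul_Lser.
rewrite !derM mulrDl; apply: rpredD; first apply: rpredD.
- by apply: Mser_mulr; apply: M3s.
- apply: Mser_mulr; apply: Mser_mull; apply: Lser_Mser.
  exact: small_der_Lser.
(* [M3s] needs the element of M_3 on the left of [s]; the commutator paid for the exchange lies deep
   enough in the series. *)
have -> : a * s * der_fun D b =
    a * (der_fun D b * s) + a * comm s (der_fun D b).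
  by rewrite /comm; nc_ring.
apply: rpredD; first by apply: Mser_mull; apply: M3s.
apply: Mser_mull; rewrite comm_anti rpredN.
by apply: Lser_Mser; apply: Lser_sub; apply: comm_Mser3_Lser.
Qed.

End SmallDerivation.

End LowerCentralSeries.

(** * Induction on polynomials *)

Section PolynomialInduction.
Variables (F : fieldType) (m : nat).

Lemma mpoly_mulX_ind (Q : {mpoly F[m]} -> Prop) :
  Q 1 -> (forall i p, Q p -> Q ('X_i * p)) ->
  (forall c p q, Q p -> Q q -> Q (c *: p + q)) -> forall p, Q p.
Proof.
move=> Q1 QX Qlin.
have Q0 : Q 0 by have := Qlin (- 1) _ _ Q1 Q1; rewrite scaleN1r addNr.
elim/mpolyind => // c a p _ _ Qp; apply: Qlin => //.
rewrite mpolyXE_id; elim: (index_enum _) => [|i s IH].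
  by rewrite big_nil.
rewrite big_cons; elim: (a i) => [|k IHk]; first by rewrite expr0 mul1r.
by rewrite exprS -mulrA; apply: QX.
Qed.

End PolynomialInduction.

(** * The Jordan algebra and the evaluation of polynomials in it *)

(* If all double commutators vanish, the Jordan product (a b + b a) / 2 is
   associative: its associator is [b, [a, c]] / 4. *)
Section JordanAlgebra.
Variables (F : fieldType) (B : algType F).

(** An alias of [B]. Its two hypotheses are parameters because the ring structure attached to the
    alias depends on them. *)
Definition jordan (two_neq0 : 2%:R != 0 :> F)
  (comm_central : forall a b c : B, comm a (comm b c) = 0) : Type := B.

Variables (two_neq0 : 2%:R != 0 :> F).
Variables (comm_central : forall a b c : B, comm a (comm b c) = 0).
Local Notation J := (jordan two_neq0 comm_central).

HB.instance Definition _ := Choice.on J.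
HB.instance Definition _ := GRing.Lmodule.on J.

Definition jmul (a b : J) : J := 2%:R^-1 *: ((a : B) * (b : B) + (b : B) * (a : B)).

Fact jmulC : commutative jmul.
Proof. by move=> a b; rewrite /jmul addrC. Qed.

Fact jmulA : associative jmul.
Proof.
move=> a b c; rewrite /jmul -!(scalerAl, scalerAr) -!scalerDr; congr (_ *: (_ *: _)).
rewrite -[LHS]add0r -(comm_central b a c) /comm; nc_ring.
Qed.

Fact jmul1r : left_id (1 : B) jmul.
Proof.
move=> a; rewrite /jmul mul1r mulr1 -mulr2n -scaler_nat scalerA mulVf //.
exact: scale1r.
Qed.

Fact jmulDl : left_distributive jmul +%R.
Proof.
move=> a b c; rewrite /jmul -scalerDr mulrDl mulrDr; congr (_ *: _).
exact: addrACA.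
Qed.

Fact jone_neq0 : (1 : B) != 0 :> J.
Proof. exact: oner_neq0. Qed.

HB.instance Definition _ := GRing.Zmodule_isComNzRing.Build J
  jmulA jmulC jmul1r jmulDl jone_neq0.

Fact jscaleAl (k : F) (a b : J) : k *: (a * b) = (k *: a : J) * b.
Proof.
change (k *: jmul a b = jmul (k *: a) b); rewrite /jmul.
by rewrite -scalerAl -scalerAr -scalerDr !scalerA mulrC.
Qed.
HB.instance Definition _ := GRing.Lmodule_isLalgebra.Build F J jscaleAl.
HB.instance Definition _ := GRing.Lalgebra_isComAlgebra.Build F J.

Lemma jmulE (a b : J) : a * b = 2%:R^-1 *: ((a : B) * (b : B) + (b : B) * (a : B)) :> B.
Proof. by []. Qed.

(** Symmetric and antisymmetric parts of the product. This is the shape of the Fedosov product, with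
    [a, b] / 2 in the role of da /\ db. *)
Lemma mul_jordan (a b : B) :
  a * b = ((a : J) * (b : J) : J) + 2%:R^-1 *: comm a b :> B.
Proof.
rewrite jmulE -scalerDr /comm addrACA subrr addr0 -mulr2n -scaler_nat scalerA.
by rewrite mulVf ?scale1r.
Qed.

Lemma jmul_central (a b : J) : comm (a : B) (b : B) = 0 -> a * b = (a : B) * (b : B) :> B.
Proof. by move=> c0; rewrite [RHS]mul_jordan c0 scaler0 addr0. Qed.

Lemma der_jordan (d : B -> B) : linear d ->
  (forall a b, d (a * b) = d a * b + a * d b) ->
  forall a b : J, d (a * b) = (d a : J) * b + a * (d b : J).
Proof.
move=> ld dM a b.
have dD x y : d (x + y) = d x + d y by rewrite -[x]scale1r ld !scale1r.
have dZ k x : d (k *: x) = k *: d x.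
  have d0 : d 0 = 0 by have := ld (- 1) 0 0; rewrite scaler0 addr0 scaleN1r addNr.
  by rewrite -[k *: x]addr0 ld d0 addr0.
rewrite !jmulE dZ dD !dM -scalerDr; congr (_ *: _); nc_ring.
Qed.

Lemma comm_jordanr (a : B) (b c : J) :
  comm a (b * c) = (comm a b : J) * c + b * (comm a c : J).
Proof. by apply: der_jordan => [|x y]; [exact: comm_linearr | rewrite comm_mulr]. Qed.

Variables (m : nat) (y : 'I_m -> B).

(** The map sym of the introductory comment, for arbitrary images [y] of the variables. *)
Definition symm (p : {mpoly F[m]}) : J := mmap (in_alg J) (y : 'I_m -> J) p.

Lemma symm_linear : linear symm.
Proof. by move=> k p q; rewrite /symm raddfD /= mmapZ mulr_algl. Qed.

Lemma symm1 : symm 1 = 1. Proof. exact: rmorph1. Qed.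

Lemma symmM p q : symm (p * q) = symm p * symm q. Proof. exact: rmorphM. Qed.

Lemma symm0 : symm 0 = 0. Proof. exact: raddf0. Qed.

Lemma symmD p q : symm (p + q) = symm p + symm q. Proof. exact: raddfD. Qed.

Lemma symm_sign k p : symm ((-1) ^+ k * p) = (-1) ^+ k * symm p.
Proof.
elim: k => [|k IH]; first by rewrite !expr0 !mul1r.
by rewrite !exprS !mulN1r !mulNr [LHS]raddfN /= -[mmap _ _ _]/(symm _) IH.
Qed.

Lemma symmX i : symm 'X_i = y i.
Proof. by rewrite /symm mmapX mmap1U. Qed.

(** This uniqueness yields the chain rule [comm_symm] and, later, the compatibility of lifts with
    [symm]. *)
Lemma symm_der_uniq (d e : {mpoly F[m]} -> J) : linear d -> linear e ->
  (forall p q, d (p * q) = d p * symm q + symm p * d q) ->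
  (forall p q, e (p * q) = e p * symm q + symm p * e q) ->
  (forall i, d 'X_i = e 'X_i) -> d =1 e.
Proof.
move=> ld le dM eM deX; have d1 f : (forall p q, f (p * q) = f p * symm q + symm p * f q) -> f 1 = 0.
  move=> fM; apply: (addrI (f 1)); rewrite addr0.
  by rewrite -{3}[1]mulr1 fM symm1 mulr1 mul1r.
apply: mpoly_mulX_ind => [|i p dep|c p q dp dq].
- by rewrite !d1.
- by rewrite dM eM deX dep.
- by rewrite ld le dp dq.
Qed.

End JordanAlgebra.

(** * Increasing enumerations of subsets and signs of wedge products *)

Section OrdinalEnumeration.
Variable m : nat.
Implicit Types (i : 'I_m) (S T : {set 'I_m}).

Lemma inversions_set1 i T : inversions [set i] T = #|[set j in T | (j < i)%N]|.
Proof.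
rewrite /inversions -(card_imset _ (f := fun j : 'I_m => (i, j))); last first.
  by move=> j k [].
apply: eq_card => -[j k]; rewrite inE /= inE; apply/and3P/imsetP.
  by move=> [/eqP-> Tk lt_ki]; exists k; rewrite // inE Tk.
by move=> [l]; rewrite inE => /andP[Tl lt_li] [-> ->].
Qed.

(** Cutting the increasing list [enum 'I_m] at [i] cuts both enumerations. The part of [enum T]
    before the cut consists of the elements below [i], which are those counted by [inversions]; so
    the sign in [wedge] is that of sorting [i] into place. *)
Lemma enum_setU1 i T : i \notin T -> exists s t,
  [/\ enum T = s ++ t, enum (i |: T) = s ++ i :: t & size s = inversions [set i] T].
Proof.
move=> niT.
have : pairwise (relpre val ltn) (enum 'I_m).
  rewrite -sorted_pairwise; last by move=> a b c; apply: ltn_trans.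
  by rewrite -sorted_map val_enum_ord iota_ltn_sorted.
have eE A : enum A = filter (mem A) (enum 'I_m) by rewrite {1}/enum_mem enumT.
case/splitPr: (mem_enum 'I_m i) (eE) => e1 e2 {}eE.
rewrite pairwise_cat pairwise_cons allrel_consr.
move=> /andP[/andP[/allP lt1 _] /andP[_ /andP[/allP lt2 _]]].
exists (filter (mem T) e1), (filter (mem T) e2); split.
- by rewrite eE filter_cat /= (negPf niT).
- rewrite eE filter_cat /= setU11; congr (_ ++ _ :: _);
    apply: eq_in_filter => j.
    by move=> /lt1 /= lt_ji; rewrite !inE -val_eqE ltn_eqF.
  by move=> /lt2 /= lt_ij; rewrite !inE -val_eqE gtn_eqF.
rewrite inversions_set1 cardE eE filter_cat size_cat /= inE ltnn andbF.
rewrite [in X in (_ + X)%N](eq_in_filter (a2 := pred0)) => [|j /lt2 /= lt_ij].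
  rewrite filter_pred0 addn0; congr size; apply: eq_in_filter => j /lt1 /= lt_ji.
  by rewrite inE lt_ji andbT.
by rewrite inE ltnNge ltnW ?andbF.
Qed.

Lemma wedge_dvar (F : fieldType) i (al : Defs.form F m) S :
  wedge (dvar F i) al S =
  if i \in S then (-1) ^+ inversions [set i] (S :\ i) * al (S :\ i) else 0.
Proof.
rewrite ffunE; case: ifPn => Si.
  rewrite (bigD1 [set i]) ?powersetE ?sub1set //= big1 => [|T /andP[_ ne]].
    by rewrite addr0 ffunE eqxx mulr1.
  by rewrite ffunE (negPf ne) mulr0 mul0r.
rewrite big1 // => T; rewrite powersetE ffunE => sTS; case: eqP => [Ti|].
  by rewrite Ti sub1set (negPf Si) in sTS.
by rewrite mulr0 mul0r.
Qed.

Lemma mderivXU (R : nzRingType) i j : ('X_j : {mpoly R[m]})^`M(i) = (j == i)%:R.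
Proof.
rewrite mderivX mnm1E; case: eqP => [->|_]; last by rewrite scale0r.
have -> : (U_(i) - U_(i) = 0)%MM by apply/mnmP => k; rewrite mnmBE subnn mnm0E.
by rewrite scale1r mpolyX0.
Qed.

Lemma dform_form0X (F : fieldType) i : dform (form0 'X_i) = dvar F i.
Proof.
rewrite dform_form0 (bigD1 i) //= big1 ?addr0 => [|j ne_ji].
  apply/ffunP => S; rewrite wedge_dvar !ffunE mderivXU eqxx.
  case: eqP => [S0|ne0].
    have -> : (i \in S) = (S == [set i]).
      apply/idP/eqP => [iS|->]; last exact: set11.
      by rewrite -(setD1K iS) S0 setU0.
    rewrite S0 inversions_set1 (_ : [set _ in _ | _] = set0) ?cards0 ?mul1r //.
    by apply/setP => j; rewrite !inE.
  by rewrite mulr0 if_same; case: eqP => // SE; case: ne0; rewrite SE setDv.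
apply/ffunP => S; rewrite wedge_dvar !ffunE mderivXU [i == j]eq_sym (negPf ne_ji).
by rewrite if_same mulr0 if_same.
Qed.

End OrdinalEnumeration.

(** * The map from differential forms to an algebra with central commutators *)

Section FormsToAlgebra.
Variables (F : fieldType) (B : algType F).
Variables (two_neq0 : 2%:R != 0 :> F).
Variables (comm_central : forall a b c : B, comm a (comm b c) = 0).
Local Notation J := (jordan two_neq0 comm_central).
Variables (m : nat) (y : 'I_m -> B).
Local Notation symm := (symm two_neq0 comm_central y).

Definition half_comm i j : J := 2%:R^-1 *: comm (y i) (y j).

(* The image of dx_s1 /\ dx_s2 /\ ... : dx_i /\ dx_j goes to [y_i, y_j] / 2
   and forms of odd degree to 0. *)
Fixpoint wedge_word (s : seq 'I_m) : J :=
  match s with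
  | [::] => 1
  | [:: _] => 0
  | i :: j :: t => half_comm i j * wedge_word t
  end.

Lemma wedge_word_ind (Q : seq 'I_m -> Prop) :
  Q [::] -> (forall i, Q [:: i]) -> (forall i j s, Q s -> Q [:: i, j & s]) ->
  forall s, Q s.
Proof.
move=> Q0 Q1 Q2 s; have [k] := ubnP (size s); elim: k s => // k IH [|i [|j s]] //.
by rewrite /= ltnS => lt_sk; apply: Q2; apply: IH; apply: ltnW.
Qed.

Lemma comm_half_comm (b : B) i j : comm b (half_comm i j : B) = 0.
Proof.
rewrite /half_comm /comm -scalerAl -scalerAr -scalerBr -[_ - _]/(comm _ _).
by rewrite comm_central scaler0.
Qed.

Lemma comm_wedge_word (b : B) s : comm b (wedge_word s : B) = 0.
Proof.
elim/wedge_word_ind: s => [|i|i j s IH] /=.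
- by rewrite /comm mulr1 mul1r subrr.
- by rewrite /comm mulr0 mul0r subrr.
by rewrite comm_jordanr IH comm_half_comm mulr0 mul0r addr0.
Qed.

Lemma half_comm_anti i j : half_comm i j = - half_comm j i.
Proof. by rewrite /half_comm comm_anti scalerN. Qed.

(* Expand [[y_i, y_j y_k], y_l] = 0. *)
Lemma half_comm_swap i j k l :
  half_comm i j * half_comm k l = - (half_comm i k * half_comm j l).
Proof.
apply: (addrI (half_comm i k * half_comm j l)); rewrite subrr.
have e a b c d : half_comm a b * half_comm c d =
    2%:R^-1 *: (2%:R^-1 *: (comm (y a) (y b) * comm (y c) (y d))) :> B.
  rewrite jmul_central ?comm_half_comm // /half_comm.
  by rewrite -scalerAl -scalerAr.
rewrite [LHS](congr2 +%R (e _ _ _ _) (e _ _ _ _)) -!scalerDr.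
suff -> : comm (y i) (y k) * comm (y j) (y l) + comm (y i) (y j) * comm (y k) (y l) = 0 :> B.
  by rewrite !scaler0.
have z a b c : comm (comm a b) c = 0 :> B by rewrite comm_anti comm_central oppr0.
have := z (y i) (y j * y k) (y l).
rewrite comm_mulr -[_ * y k]scale1r comm_linearl scale1r !comm_mull !z mul0r mulr0.
rewrite addr0 add0r addrC => <-; congr (_ + _).
by apply/eqP; rewrite -subr_eq0 -[_ - _]/(comm _ _) z.
Qed.

(** The parity of the length of [p] decides: the swapped letters form one block of [wedge_word], and
    [half_comm_anti] applies, or they straddle two blocks, and [half_comm_swap] applies. *)
Lemma wedge_word_swap p i j s :
  wedge_word (p ++ [:: i, j & s]) = - wedge_word (p ++ [:: j, i & s]).
Proof.
elim/wedge_word_ind: p => [|k|k l p IH] /=.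
- by rewrite half_comm_anti mulNr.
- case: s => [|l s] /=; first by rewrite !mulr0 oppr0.
  by rewrite !mulrA half_comm_swap mulNr.
- by rewrite IH mulrN.
Qed.

Lemma wedge_word_dup p i s : wedge_word (p ++ [:: i, i & s]) = 0.
Proof.
have /eqP := wedge_word_swap p i i s.
rewrite -addr_eq0 -mulr2n -scaler_nat scaler_eq0 (negPf two_neq0) /=.
by move/eqP.
Qed.

Lemma wedge_word_move p i s t :
  wedge_word (p ++ i :: s ++ t) = (-1) ^+ size s * wedge_word (p ++ s ++ i :: t).
Proof.
elim: s p => [|j s IH] p; first by rewrite mul1r.
rewrite cat_cons wedge_word_swap -cat_rcons IH cat_rcons.
by rewrite exprS mulN1r mulNr.
Qed.

Lemma wedge_word_mem p i s : i \in s -> wedge_word (p ++ i :: s) = 0.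
Proof.
by case/splitPr=> s1 s2; rewrite wedge_word_move catA wedge_word_dup mulr0.
Qed.

(** Together with [wedge_dvar] this says that [wedge_word] obeys the sign rule of the exterior
    algebra. *)
Lemma wedge_word_insert p i (T : {set 'I_m}) :
  wedge_word (p ++ i :: enum T) =
  if i \in T then 0
  else (-1) ^+ inversions [set i] T * wedge_word (p ++ enum (i |: T)).
Proof.
case: ifPn => [iT|/enum_setU1 [s [t [-> -> <-]]]]; last exact: wedge_word_move.
by rewrite wedge_word_mem ?mem_enum.
Qed.

(** The image of dx_s1 /\ ... /\ dx_sr /\ al. With the prefix [s], left multiplication by dx_i
    amounts to appending a letter ([of_form_wedge]). *)
Definition of_form (s : seq 'I_m) (al : Defs.form F m) : J :=
  \sum_(T : {set 'I_m}) symm (al T) * wedge_word (s ++ enum T).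

Lemma of_form_linear s : linear (of_form s).
Proof.
move=> c al be; rewrite /of_form scaler_sumr -big_split; apply: eq_bigr => T _ /=.
by rewrite !ffunE symm_linear mulrDl scalerAl.
Qed.

HB.instance Definition _ s :=
  GRing.isLinear.Build F (Defs.form F m) J *:%R (of_form s) (of_form_linear s).

Lemma of_form0 p : of_form [::] (form0 p) = symm p.
Proof.
rewrite /of_form (bigD1 set0) //= big1 => [|T /negPf T0].
  by rewrite ffunE eqxx enum_set0 mulr1 addr0.
by rewrite ffunE T0 symm0 mul0r.
Qed.

Lemma of_form_wedge s i al :
  of_form s (wedge (dvar F i) al) = of_form (rcons s i) al.
Proof.
rewrite /of_form (bigID (fun T : {set 'I_m} => i \in T)) /= addrC big1 ?add0r; last first.
  by move=> T /negPf niT; rewrite wedge_dvar niT symm0 mul0r.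
rewrite [RHS](bigID (fun T : {set 'I_m} => i \in T)) /= [X in _ = X + _]big1 ?add0r; last first.
  by move=> T iT; rewrite cat_rcons wedge_word_insert iT mulr0.
(* Only sets containing [i] survive on the left and only sets avoiding [i] on the right; adding [i]
   matches them. *)
rewrite (reindex_onto (fun T => i |: T) (fun T => T :\ i)) /=; last first.
  by move=> T iT; rewrite setD1K.
apply: eq_big => T.
  rewrite setU11 /=; apply/eqP/idP => [<-|niT]; first by rewrite setD11.
  by rewrite setU1K.
move=> /andP[_ /eqP TE]; have niT : i \notin T by rewrite -TE setD11.
rewrite wedge_dvar setU11 TE cat_rcons wedge_word_insert (negPf niT).
by rewrite symm_sign mulrCA mulrA.
Qed.

(** The chain rule for [b, -]: both sides are derivations along [symm] that agree on the
    variables. *)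
Lemma comm_symm (b : B) p :
  comm b (symm p : B) = \sum_j symm (p^`M(j)) * (comm b (y j) : J) :> J.
Proof.
have lc : linear (fun p => comm b (symm p : B) : J).
  by move=> c q r; rewrite symm_linear comm_linearr.
move: p; apply: (symm_der_uniq lc) => [c q r|q r|q r|i].
- rewrite scaler_sumr -big_split; apply: eq_bigr => j _ /=.
  by rewrite linearP symm_linear mulrDl scalerAl.
- by rewrite symmM comm_jordanr.
- rewrite mulr_suml mulr_sumr -big_split; apply: eq_bigr => j _ /=.
  rewrite mderivM symmD !symmM mulrDl; congr (_ + _).
    by rewrite mulrAC.
  by rewrite mulrA.
rewrite symmX (bigD1 i) //= big1 => [|j ne_ji].
  by rewrite mderivXU eqxx symm1 mul1r addr0.
by rewrite mderivXU [i == j]eq_sym (negPf ne_ji) symm0 mul0r.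
Qed.

(** Wedge words are central, so [b, -] acts on the coefficients only. *)
Lemma comm_of_form (b : B) s al :
  comm b (of_form s al : B) =
  \sum_(T : {set 'I_m}) \sum_j
    symm ((al T)^`M(j)) * (comm b (y j) : J) * wedge_word (s ++ enum T) :> J.
Proof.
pose c : J -> J := comm b.
have cD : {morph c : u v / u + v}.
  by move=> u v; rewrite -[u]scale1r [LHS]comm_linearr !scale1r.
have c0 : c 0 = 0 by rewrite /c /comm mulr0 mul0r subrr.
rewrite [LHS](big_morph c cD c0); apply: eq_bigr => T _.
rewrite /c comm_jordanr comm_wedge_word mulr0 addr0 comm_symm.
exact: mulr_suml.
Qed.

(** The two terms of the Fedosov product match the two terms of [mul_jordan]: x_i al gives the
    Jordan product, and dx_i /\ d al gives half the commutator with [y i], by [comm_of_form]. *)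
Lemma of_form_fedosov i al :
  of_form [::] (fedosov (form0 'X_i) al) = y i * (of_form [::] al : B) :> B.
Proof.
have scale_mulA (k : F) (u v w : J) : u * ((k *: v : J) * w) = k *: (u * v * w).
  by rewrite -scalerAl -scalerAr mulrA.
rewrite mul_jordan /fedosov dform_form0X linearD /=; congr (_ + _).
  rewrite wedge_form0 mulr_sumr; apply: eq_bigr => T _.
  by rewrite ffunE symmM symmX mulrA.
rewrite of_form_wedge linear_sum /=.
rewrite comm_of_form scaler_sumr (eq_bigr _ (fun j _ => of_form_wedge _ _ _)) /=.
rewrite exchange_big /=; apply: eq_bigr => T _; rewrite scaler_sumr.
apply: eq_bigr => j _.
rewrite ffunE; exact: scale_mulA.
Qed.

End FormsToAlgebra.

(** * The free algebra: words, derivations, and linearity of the Feigin-Shoikhet map *)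

Section FreeAlgebraTheory.
Import monalg.
Variables (F : fieldType) (m : nat).
Local Notation A := (freealg F m).
Local Notation word := (seq 'I_m).

Definition monom (w : word) : A := \prod_(i <- w) gen F i.

Lemma monomE (w : {fmonom 'I_m}) : monom w = mkmalgU w 1.
Proof.
rewrite -[in RHS](fmK w); case: w => w /=; rewrite /monom.
elim: w => [|i w IH]; first by rewrite big_nil -fmoneE.
rewrite big_cons IH /gen [LHS]malgM_def fgmulUU mulr1.
by congr mkmalgU; rewrite fmuE [LHS]fmmulE.
Qed.

(** Extension from the basis of words; [feigin_shoikhet] is by conversion the instance where [f] is
    a [foldr]. *)
Definition linear_ext (V : lmodType F) (f : word -> V) (a : A) : V :=
  \sum_(w <- msupp a) mcoeff w a *: f w.

Section LinearExtension.
Variables (V : lmodType F) (f : word -> V).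

Lemma linear_extEw (d : {fset {fmonom 'I_m}}) (a : A) :
  fsubset (msupp a) d ->
  linear_ext f a = \sum_(w <- d) mcoeff w a *: f w.
Proof.
move=> le; rewrite /linear_ext (big_fset_incl _ le) //= => x xd.
by move/mcoeff_outdom => ->; rewrite scale0r.
Qed.

Lemma linear_ext_linear : linear (linear_ext f).
Proof.
move=> c a b; pose d := fsetU (msupp a) (msupp b).
rewrite (@linear_extEw d (c *: a + b)); last first.
  apply: fsubset_trans (msuppD_le _ _) _; apply: fsetSU.
  exact: msuppZ_le.
rewrite (@linear_extEw d a) ?fsubsetUl // (@linear_extEw d b) ?fsubsetUr //.
rewrite scaler_sumr -big_split; apply: eq_bigr => w _ /=.
by rewrite mcoeffD mcoeffZ scalerDl scalerA.
Qed.

Lemma linear_ext_monom w : linear_ext f (monom w) = f w.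
Proof.
rewrite (monomE (FMonom w)) /linear_ext msuppU oner_eq0.
by rewrite big_seq_fset1 mcoeffUU scale1r.
Qed.

End LinearExtension.

Lemma freealg_monom_ind (Q : A -> Prop) : (forall w, Q (monom w)) ->
  (forall c a b, Q a -> Q b -> Q (c *: a + b)) -> forall a, Q a.
Proof.
move=> Qm Ql a; rewrite [a]monalgE.
have Q0 : Q 0 by rewrite -(addNr (monom [::])) -scaleN1r; apply: Ql.
elim: (enum_fset _) => [|w s IH]; first by rewrite big_nil.
rewrite big_cons.
have -> : mkmalgU w (mcoeff w a) = mcoeff w a *: monom w.
  apply/malgP => k; rewrite monomE mcoeffZ [LHS]mcoeffU [in RHS]mcoeffU.
  by rewrite mulr_natr.
exact: Ql.
Qed.

Lemma freealg_ind (Q : A -> Prop) : Q 1 -> (forall i a, Q a -> Q (gen F i * a)) ->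
  (forall c a b, Q a -> Q b -> Q (c *: a + b)) -> forall a, Q a.
Proof.
move=> Q1 Qg Ql; apply: freealg_monom_ind => // w; rewrite /monom.
by elim: w => [|i w IH]; rewrite ?big_nil ?big_cons //; apply: Qg.
Qed.

Fixpoint der_word (u : 'I_m -> A) (w : word) : A :=
  if w is i :: w' then u i * monom w' + gen F i * der_word u w' else 0.

Fact der_step (R : nzRingType) (g u a b a' b' : R) :
  u * (a * a') + g * (b * a' + a * b') = (u * a + g * b) * a' + g * a * b'.
Proof. nc_ring. Qed.

Fact der_linr (R : algType F) (d : R -> R) (ld : linear d) c a b b' :
  d (a * b) = d a * b + a * d b -> d (a * b') = d a * b' + a * d b' ->
  d (a * (c *: b + b')) = d a * (c *: b + b') + a * d (c *: b + b').
Proof.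
by move=> e e'; rewrite mulrDr -scalerAr !ld e e' !mulrDr -!scalerAr scalerDr addrACA.
Qed.

Fact der_linl (R : algType F) (d : R -> R) (ld : linear d) c a a' b :
  d (a * b) = d a * b + a * d b -> d (a' * b) = d a' * b + a' * d b ->
  d ((c *: a + a') * b) = d (c *: a + a') * b + (c *: a + a') * d b.
Proof.
by move=> e e'; rewrite mulrDl -scalerAl !ld e e' !mulrDl -!scalerAl scalerDr addrACA.
Qed.

(** The Leibniz rule is proved for two words by induction on the first one, then extended linearly
    in each argument. *)
Lemma linear_ext_der u : is_derivation (linear_ext (der_word u)).
Proof.
set d := linear_ext _; have ld : linear d by apply: linear_ext_linear.
split=> // a b; elim/freealg_monom_ind: a => [w|c a a' IHa IHa'].
  elim/freealg_monom_ind: b => [w'|c b b' IHb IHb'].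
    have <- : monom (w ++ w') = monom w * monom w' by rewrite /monom big_cat.
    rewrite /d !linear_ext_monom; elim: w => [|i w IH] /=.
      by rewrite /monom big_nil mul0r mul1r add0r.
    have mC v : monom (i :: v) = gen F i * monom v by rewrite /monom big_cons.
    have -> : monom (w ++ w') = monom w * monom w' by rewrite /monom big_cat.
    by rewrite IH mC; apply: der_step.
  exact: (der_linr ld).
exact: (der_linl ld).
Qed.

Definition free_der (u : 'I_m -> A) : der A :=
  exist (fun D : A -> A => D \in derivation A) _ (asboolT (linear_ext_der u)).

Lemma free_der_gen u i : der_fun (free_der u) (gen F i) = u i.
Proof.
rewrite /der_fun /=; have -> : gen F i = monom [:: i] by rewrite /monom big_seq1.
by rewrite linear_ext_monom /= /monom big_nil mulr1 mulr0 addr0.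
Qed.

Lemma der1 (D : der A) : der_fun D 1 = 0.
Proof.
apply: (addrI (der_fun D 1)); rewrite addr0 -{3}[1]mulr1.
by rewrite derM mulr1 mul1r.
Qed.

Lemma small_der_gen (D : der A) :
  (forall i, der_fun D (gen F i) \in Mser A 3) ->
  forall a, der_fun D a \in Mser A 3.
Proof.
move=> sD; apply: freealg_ind => [|i a IH|c a b Ma Mb].
- by rewrite der1 rpred0.
- by rewrite derM rpredD // ?(Mser_mulr _ (sD i)) // Mser_mull.
- by rewrite der_linear rpredD // rpredZ.
Qed.

Lemma feigin_shoikhet_linear : linear (@feigin_shoikhet F m : A -> _).
Proof. exact: (linear_ext_linear (foldr _ _)). Qed.

Lemma feigin_shoikhet1 : @feigin_shoikhet F m 1 = form0 1.
Proof.
have -> : (1 : A) = monom [::] by rewrite /monom big_nil.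
exact: (linear_ext_monom (foldr _ _)).
Qed.

Lemma form0D (p q : mpoly m F) : form0 (p + q) = form0 p + form0 q.
Proof. by apply/ffunP => S; rewrite !ffunE; case: ifP; rewrite ?addr0. Qed.

Lemma form0Z c (p : mpoly m F) : form0 (c *: p) = c *: form0 p.
Proof. by apply/ffunP => S; rewrite !ffunE; case: ifP; rewrite ?scaler0. Qed.

Lemma wedgeDr al : {morph wedge (al : Defs.form F m) : be ga / be + ga}.
Proof.
move=> be ga; apply/ffunP => S; rewrite !ffunE -big_split.
by apply: eq_bigr => T _ /=; rewrite !ffunE mulrDr.
Qed.

Lemma wedgeZr al c (be : Defs.form F m) : wedge al (c *: be) = c *: wedge al be.
Proof.
apply/ffunP => S; rewrite !ffunE scaler_sumr.
by apply: eq_bigr => T _ /=; rewrite !ffunE scalerAr.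
Qed.

Lemma dform_linear : linear (@dform F m).
Proof.
move=> c al be; rewrite /dform scaler_sumr -big_split; apply: eq_bigr => i _ /=.
rewrite -wedgeZr -wedgeDr; congr wedge; apply/ffunP => S.
by rewrite !ffunE linearP.
Qed.

Lemma fedosov_linear (al : Defs.form F m) : linear (fedosov al).
Proof.
move=> c be ga; rewrite /fedosov dform_linear !wedgeDr !wedgeZr scalerDr.
by rewrite addrACA.
Qed.

Fact mull_linear (R : algType F) (g : R) : linear (fun a : R => g * a).
Proof. by move=> c a b; rewrite mulrDr -scalerAr. Qed.

Lemma feigin_shoikhet_genM i (a : A) :
  @feigin_shoikhet F m (gen F i * a) = fedosov (form0 'X_i) (feigin_shoikhet a).
Proof.
elim/freealg_monom_ind: a => [w|c a b IHa IHb].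
  have -> : gen F i * monom w = monom (i :: w) by rewrite /monom big_cons.
  have e v : feigin_shoikhet (monom v) =
      foldr (fun i al => fedosov (form0 'X_i) al) (form0 1) v.
    exact: (linear_ext_monom (foldr _ _)).
  by rewrite !e.
rewrite (mull_linear (gen F i) c a b) (feigin_shoikhet_linear c a b).
rewrite fedosov_linear -IHa -IHb; exact: feigin_shoikhet_linear.
Qed.

End FreeAlgebraTheory.

Lemma hom_comm (F : fieldType) (A A' : algType F) (f : A -> A') (lf : linear f)
  (fM : forall a b, f (a * b) = f a * f b) a b : f (comm a b) = comm (f a) (f b).
Proof. by rewrite /comm addrC -scaleN1r lf !fM scaleN1r addrC. Qed.

(** * Properness of M_3 *)

Section Mser3Proper.
Import monalg.
Variables (F : fieldType) (m : nat).
Local Notation A := (freealg F m).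

Fact character_Lser2 (B : algType F) (e : {linear B -> F^o}) :
  (forall a b, e (a * b) = e a * e b) -> forall x, x \in Mser B 2 -> e x = 0.
Proof.
move=> eM x /lspanP; elim=> [|c z u [a [s [b [Ls ->]]]] _ eu]; first exact: raddf0.
rewrite linearP eu !eM; suff -> : e s = 0 by rewrite mulr0 mul0r scaler0 addr0.
move/lspanP: Ls; elim=> [|d w v [p [q [_ ->]]] _ ev]; first exact: raddf0.
by rewrite linearP ev raddfB /= !eM mulrC subrr scaler0 addr0.
Qed.

(** The constant term is a character, so it kills commutators and hence M_2, which contains M_3; but
    it sends 1 to 1. *)
Fact Mser3_proper : 1 \notin Mser A 3.
Proof.
pose e (a : A) : F^o := mcoeff (@one {fmonom _}) a.
have eM a b : e (a * b) = e a * e b by exact: rmorphM.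
have el : linear e by move=> c y v; rewrite /e mcoeffD mcoeffZ.
pose e' : {linear A -> F^o} := HB.pack e (GRing.isLinear.Build F A F^o *:%R e el).
apply/negP => /Mser_sub h; have := character_Lser2 (e := e') eM h.
by rewrite /= /e mcoeff1 eqxx => /eqP; rewrite oner_eq0.
Qed.

End Mser3Proper.

(** * The quotient A / M_3 and a left inverse of the Feigin-Shoikhet map *)

Section QuotientByMser3.
Variables (F : fieldType) (m : nat).
Hypothesis two_neq0 : 2%:R != 0 :> F.
Local Notation A := (freealg F m).

Definition Mser3_ideal : Defs.proper_ideal A :=
  @Defs.ProperIdeal _ _ (Mser A 3) (@Mser3_proper F m)
    (@Mser_mull _ _ 3) (@Mser_mulr _ _ 3).

Definition quot3 := quot_alg Mser3_ideal.
HB.instance Definition _ := GRing.Algebra.on quot3.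

Definition proj3 : A -> quot3 := acls Mser3_ideal.

Lemma proj3_linear : linear proj3. Proof. exact: acls_linear. Qed.
Lemma proj3M a b : proj3 (a * b) = proj3 a * proj3 b. Proof. exact: aclsM. Qed.
Lemma proj3_eq a b : proj3 a = proj3 b <-> a - b \in Mser A 3.
Proof. exact: qcls_eq. Qed.
Lemma proj3_surj (b : quot3) : exists a, proj3 a = b.
Proof. by exists (qrep b); apply: qrepK. Qed.

Lemma proj3_comm a b : comm (proj3 a) (proj3 b) = proj3 (comm a b).
Proof. by rewrite (hom_comm proj3_linear proj3M). Qed.

Lemma quot3_comm (a b c : quot3) : comm a (comm b c) = 0.
Proof.
have [x <-] := proj3_surj a; have [y <-] := proj3_surj b.
have [z <-] := proj3_surj c; rewrite !proj3_comm.
have -> : 0 = proj3 0.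
  by have := proj3_linear (- 1) 0 0; rewrite scaler0 addr0 scaleN1r addNr.
apply/proj3_eq; rewrite subr0; apply: Lser_Mser.
by do 2 apply: Lser_comm.
Qed.

Definition gen3 (i : 'I_m) : quot3 := proj3 (gen F i).

(** Induction on multiplication by a generator; each step is [of_form_fedosov]. *)
Lemma of_form_feigin_shoikhet a :
  of_form two_neq0 quot3_comm gen3 [::] (feigin_shoikhet a) = proj3 a.
Proof.
elim/freealg_ind: a => [|i a IH|c a b IHa IHb].
- by rewrite feigin_shoikhet1 of_form0 symm1.
- by rewrite feigin_shoikhet_genM of_form_fedosov IH proj3M.
- by rewrite feigin_shoikhet_linear of_form_linear IHa IHb proj3_linear.
Qed.

(** This turns the condition [lifts], stated with forms, into equations in A / M_3. *)
Lemma feigin_shoikhet_function a p : feigin_shoikhet a = form0 p ->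
  proj3 a = symm two_neq0 quot3_comm gen3 p.
Proof. by rewrite -of_form_feigin_shoikhet => ->; rewrite of_form0. Qed.

End QuotientByMser3.

(** * Powers of linear forms, and existence of lifts *)

Section PowersOfLinearForms.
Variables (F : fieldType).
Hypothesis char0 : forall k, k.+1%:R != 0 :> F.

(* For p(t) = \sum_(j <= N) t^j c_j, the curve p(2 t) - 2^N p(t) stays in U and
   has no term of degree N. *)
Lemma curve_coef_mem (V : lmodType F) (U : lsubspace V) N (c : nat -> V) :
  (forall t : F, \sum_(j < N) t ^+ j *: c j \in U) ->
  forall j, (j < N)%N -> c j \in U.
Proof.
elim: N c => // N IH c cU.
have cN j : (j < N)%N -> c j \in U.
  move=> lt_jN; pose a := (2%:R ^+ j - 2%:R ^+ N : F).
  have a0 : a != 0.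
    rewrite /a -opprB oppr_eq0 -!natrX -natrB; last by rewrite leq_exp2l // ltnW.
    have : (0 < 2 ^ N - 2 ^ j)%N by rewrite subn_gt0 ltn_exp2l.
    by case: (_ - _)%N.
  have -> : c j = a^-1 *: (a *: c j) by rewrite scalerA mulVf ?scale1r.
  apply: rpredZ.
  apply: (IH (fun j => (2%:R ^+ j - 2%:R ^+ N) *: c j)) lt_jN => t.
  have := rpredB (cU (2%:R * t)) (rpredZ (2%:R ^+ N) (cU t)).
  rewrite !big_ord_recr /= scalerDr opprD addrACA scalerA -exprMn subrr addr0.
  rewrite scaler_sumr -sumrB; congr (_ \in U); apply: eq_bigr => i _.
  by rewrite !scalerA -scalerBl mulrBr exprMn ![_ * t ^+ _]mulrC.
move=> j; rewrite ltnS leq_eqVlt => /predU1P[->|]; last exact: cN.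
have := rpredB (cU 1) (_ : \sum_(j < N) 1 ^+ j *: c j \in U).
rewrite big_ord_recr /= [_ + 1 ^+ N *: _]addrC addrK expr1n scale1r; apply.
by apply: rpred_sum => i _; rewrite rpredZ ?cN.
Qed.

Variable m : nat.

Definition linform (V : lmodType F) (x : 'I_m -> V) (c : 'I_m -> F) : V :=
  \sum_i c i *: x i.
Local Notation ell := (linform (fun i => 'X_i : {mpoly F[m]})).

(** It suffices that the span is stable under multiplication by a variable: (k + 1) l^k x_i is the
    coefficient of t in (l + t x_i)^(k+1), and [curve_coef_mem] extracts it. *)
Lemma linform_powers_span p :
  p \in lspan (fun q : {mpoly F[m]} => exists c k, q = ell c ^+ k).
Proof.
set U := lspan _.
have mulX_lin i : linear (fun p : {mpoly F[m]} => 'X_i * p).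
  by move=> a q r; rewrite mulrDr scalerAr.
elim/mpoly_mulX_ind: p => [|i p|a p q Up Uq]; first 1 last.
- apply: (lspan_homo (mulX_lin i)) => _ [c [k ->]].
  pose b j := (ell c ^+ (k.+1 - j) * 'X_i ^+ j) *+ 'C(k.+1, j).
  have : b 1%N \in U.
    apply: (@curve_coef_mem _ _ k.+2) => // t.
    have -> : \sum_(j < k.+2) t ^+ j *: b j =
        ell (fun j => c j + t * (j == i)%:R) ^+ k.+1.
      have -> : ell (fun j => c j + t * (j == i)%:R) = ell c + t *: 'X_i.
        rewrite /linform (eq_bigr _ (fun j _ => scalerDl _ _ _)) big_split /=.
        congr (_ + _); rewrite (bigD1 i) //= eqxx mulr1 big1 ?addr0 // => j.
        by move/negPf->; rewrite mulr0 scale0r.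
      rewrite exprDn; apply: eq_bigr => j _.
      by rewrite /b exprZn -scalerAr scalerMnr.
    by apply: mem_lspan; exists (fun j => c j + t * (j == i)%:R), k.+1.
  rewrite /b subn1 bin1 expr1 => Ub.
  rewrite mulrC -[_ * _]scale1r -(mulVf (char0 k)) -scalerA rpredZ //.
  by rewrite scaler_nat.
- by rewrite rpredD // rpredZ.
- by apply: mem_lspan; exists (fun=> 0), 0%N; rewrite expr0.
Qed.

Lemma mderiv_linform i c : (ell c)^`M(i) = (c i)%:MP.
Proof.
rewrite /linform raddf_sum (bigD1 i) //= big1 ?addr0 => [|j ne_ji].
  by rewrite mderivZ mderivXU eqxx -mul_mpolyC mulr1.
by rewrite mderivZ mderivXU (negPf ne_ji) scaler0.
Qed.

Lemma mderiv_linform_exp i c k :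
  (ell c ^+ k.+1)^`M(i) = (k.+1%:R * c i) *: ell c ^+ k.
Proof.
have e q : (c i)%:MP * q = c i *: q by rewrite mul_mpolyC.
elim: k => [|k IH]; first by rewrite expr1 mderiv_linform mul1r -e mulr1.
rewrite exprS mderivM IH mderiv_linform e -scalerAr -exprS -scalerDl.
by rewrite [in RHS](natrD _ 1) mulrDl mul1r.
Qed.

Lemma inversions_set11 (i j : 'I_m) : inversions [set i] [set j] = (j < i)%N.
Proof.
rewrite inversions_set1; case: ltnP => lt_ji.
  rewrite (_ : [set _ in _ | _] = [set j]) ?cards1 //.
  by apply/setP => k; rewrite !inE; case: eqP => // ->.
by apply: eq_card0 => k; rewrite !inE; case: eqP => // ->; rewrite ltnNge lt_ji.
Qed.

Lemma wedge_dvar2 i j (r : {mpoly F[m]}) S :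
  wedge (dvar F i) (wedge (dvar F j) (form0 r)) S =
  if (i != j) && (S == [set i; j]) then (-1) ^+ (j < i)%N * r else 0.
Proof.
have inv0 : inversions [set j] set0 = 0%N.
  by rewrite inversions_set1; apply: eq_card0 => k; rewrite !inE.
rewrite wedge_dvar; case: ifP => Si; last first.
  case: (S =P _) => [SE|_]; last by rewrite andbF.
  by rewrite SE !inE eqxx in Si.
rewrite wedge_dvar; case: ifP => Sj; last first.
  rewrite mulr0; case: (S =P _) => [SE|_]; last by rewrite andbF.
  by move: Sj; rewrite SE !inE eqxx orbT andbT eq_sym => ->.
rewrite ffunE; have ne : j != i by move: Sj; rewrite !inE => /andP[].
have -> : (S :\ i :\ j == set0) = (S == [set i; j]).
  apply/eqP/eqP => [S0|->]; last by apply/setP => k; rewrite !inE; case: eqP; case: eqP.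
  by rewrite -(setD1K Si) -(setD1K Sj) S0 setU0.
rewrite [i == j]eq_sym ne /=; case: (S =P _) => [SE|_]; last by rewrite !mulr0.
have -> : S :\ i = [set j].
  by rewrite SE; apply/setP => k; rewrite !inE; case: eqP => // ->; rewrite eq_sym (negPf ne).
by rewrite setDv inv0 mul1r inversions_set11.
Qed.

Fact formZE c (al : Defs.form F m) S : (c *: al) S = c *: al S.
Proof. by rewrite ffunE. Qed.

(** This is dl /\ dl /\ r = 0 for the linear form l with coefficients [c]: exchanging the two
    indices shows that each coefficient equals its opposite. *)
Lemma dlinform_sqr c (r : {mpoly F[m]}) :
  \sum_i \sum_j c i *: (c j *: wedge (dvar F i) (wedge (dvar F j) (form0 r))) = 0.
Proof.
apply/ffunP => S; rewrite sum_ffunE ffunE.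
rewrite (eq_bigr _ (fun i _ => sum_ffunE _ _ _ _)).
have e i j : (c i *: (c j *: wedge (dvar F i) (wedge (dvar F j) (form0 r)))) S =
    (c i * c j) *: (if (i != j) && (S == [set i; j]) then (-1) ^+ (j < i)%N * r else 0).
  by rewrite scalerA; apply: etrans (formZE _ _ _) (congr1 _ (wedge_dvar2 _ _ _ _)).
rewrite (eq_bigr _ (fun i _ => eq_bigr _ (fun j _ => e i j))).
set s := LHS; have ss : s = - s.
  rewrite {1}/s exchange_big /= /s -sumrN; apply: eq_bigr => i _.
  rewrite -sumrN; apply: eq_bigr => j _.
  rewrite [c j * _]mulrC -scalerN; congr (_ *: _).
  rewrite eq_sym setUC; case: ifP => [/andP[ne _]|_]; last by rewrite oppr0.
  case: (ltngtP i j) => [||/val_inj eij]; rewrite ?mulN1r ?mul1r ?opprK //.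
  by rewrite eij eqxx in ne.
have /eqP : s + s = 0 by rewrite {2}ss subrr.
by rewrite -mulr2n -scaler_nat scaler_eq0 (negPf (char0 1)) => /eqP.
Qed.

Local Notation A := (freealg F m).
Local Notation ellA := (linform (@gen F m : 'I_m -> A)).

Lemma fedosov_form0X i (q : {mpoly F[m]}) :
  fedosov (form0 'X_i) (form0 q) = form0 ('X_i * q) +
    \sum_j wedge (dvar F i) (wedge (dvar F j) (form0 (q^`M(j)))).
Proof.
rewrite /fedosov wedge_form0 dform_form0X dform_form0; congr (_ + _).
  by apply/ffunP => S; rewrite !ffunE; case: ifP; rewrite ?mulr0.
have w0 : wedge (dvar F i) 0 = 0.
  by have := wedgeZr (dvar F i) 0 0; rewrite !scale0r.
exact: (big_morph _ (@wedgeDr _ _ _) w0).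
Qed.

Lemma feigin_shoikhet_linform_mul c (a : A) :
  @feigin_shoikhet F m (ellA c * a) =
  \sum_i c i *: fedosov (form0 'X_i) (feigin_shoikhet a).
Proof.
pose phi : {linear A -> Defs.form F m} := HB.pack (@feigin_shoikhet F m)
  (GRing.isLinear.Build F A (Defs.form F m) *:%R _ (@feigin_shoikhet_linear F m)).
have mull_sum (R : algType F) (x : 'I_m -> R) b :
    linform x c * b = \sum_i c i *: (x i * b).
  by rewrite mulr_suml; apply: eq_bigr => i _; rewrite scalerAl.
rewrite [ellA c * a]mull_sum -[LHS]/(phi _) linear_sum; apply: eq_bigr => i _.
by rewrite linearZ; congr (_ *: _); exact: feigin_shoikhet_genM.
Qed.

(** In l * l^k the Fedosov correction is dl /\ d(l^k), a multiple of dl /\ dl /\ l^(k-1), which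
    vanishes; so powers of l are computed as for functions. *)
Lemma feigin_shoikhet_linform_exp c k :
  @feigin_shoikhet F m (ellA c ^+ k) = form0 (ell c ^+ k).
Proof.
elim: k => [|k IH]; first exact: feigin_shoikhet1.
rewrite exprS feigin_shoikhet_linform_mul IH.
rewrite (eq_bigr _ (fun i _ => congr1 _ (fedosov_form0X i _))).
rewrite (eq_bigr _ (fun i _ => scalerDr _ _ _)) big_split /=.
rewrite [X in _ + X](_ : _ = 0) ?addr0.
  rewrite exprS /linform mulr_suml.
  rewrite (big_morph _ (@form0D F m) (_ : form0 0 = 0)).
    by apply: eq_bigr => i _; rewrite -form0Z scalerAl.
  by apply/ffunP => S; rewrite !ffunE if_same.
case: k {IH} => [|k].
  rewrite big1 // => i _; rewrite big1 ?scaler0 // => j _.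
  by rewrite expr0 -mpolyC1 mderivC -(scale0r 0) form0Z !wedgeZr scale0r.
have := congr1 (GRing.scale k.+1%:R) (dlinform_sqr c (ell c ^+ k)).
rewrite [RHS]scaler0; apply: etrans; rewrite [RHS]scaler_sumr.
apply: eq_bigr => i _; rewrite !scaler_sumr; apply: eq_bigr => j _.
by rewrite mderiv_linform_exp form0Z !wedgeZr !scalerA mulrCA mulrA.
Qed.

Lemma feigin_shoikhet_onto p : exists a : A, feigin_shoikhet a = form0 p.
Proof.
have /lspanP := linform_powers_span p; elim=> [|c _ q [d [k ->]] _ [a aE]].
  exists 0; have := feigin_shoikhet_linear (- 1) (0 : A) 0.
  rewrite scaler0 addr0 scaleN1r addNr => ->.
  by apply/ffunP => S; rewrite !ffunE if_same.
exists (c *: ellA d ^+ k + a).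
rewrite (feigin_shoikhet_linear c) feigin_shoikhet_linform_exp aE.
by rewrite form0D form0Z.
Qed.

(** Every function is a Feigin-Shoikhet image and a derivation may take any values on the
    generators, so a lift exists and [xget] does not return its default value 0. *)
Lemma lift_derP (v : der {mpoly F[m]}) : lifts v (lift_der v).
Proof.
apply: classical_sets.xgetPex.
have [u uE] := choice (fun i => feigin_shoikhet_onto (der_fun v 'X_i)).
by exists (free_der u) => i; rewrite free_der_gen.
Qed.

End PowersOfLinearForms.

(** * Lifts of Hamiltonian fields that kill omega *)

Section HamiltonianLifts.
Variables (F : fieldType) (n : nat).
Hypothesis char0 : forall k, k.+1%:R != 0 :> F.

Section Abstract.
Variables (R : algType F) (x : 'I_(n + n) -> R) (c : 'I_(n + n) -> F) (L : R).

(** For a derivation with values [u] on the generators, the left side is twice the image of omega.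
    It is used with [L] = l^(k-1), where the right side is a multiple of [l^(k-1), l]. *)
Lemma sum_comm_linform (u : 'I_(n + n) -> R) :
  (forall i, u (lshift n i) = c (rshift n i) *: L) ->
  (forall i, u (rshift n i) = - c (lshift n i) *: L) ->
  \sum_(i < n) (comm (u (lshift n i)) (x (rshift n i)) +
                comm (x (lshift n i)) (u (rshift n i))) = comm L (linform x c).
Proof.
move=> ul ur; rewrite /comm /linform mulr_sumr mulr_suml -sumrB big_split_ord /=.
rewrite [LHS]big_split [LHS]addrC /=; congr (_ + _); apply: eq_bigr => i _.
  by rewrite ur -!scalerAl -!scalerAr !scaleNr opprK addrC.
by rewrite ul -!scalerAl -!scalerAr.
Qed.

Lemma der_sum_comm (D : der R) :
  der_fun D (2%:R^-1 *: \sum_(i < n) comm (x (lshift n i)) (x (rshift n i))) =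
  2%:R^-1 *: \sum_(i < n) (comm (der_fun D (x (lshift n i))) (x (rshift n i)) +
                comm (x (lshift n i)) (der_fun D (x (rshift n i)))).
Proof.
pose d : {linear R -> R} := HB.pack (der_fun D)
  (GRing.isLinear.Build F R R *:%R _ (der_linear D)).
rewrite -[LHS]/(d _) linearZ linear_sum; congr (_ *: _).
by apply: eq_bigr => i _; apply: der_comm.
Qed.

Lemma comm_exp k : comm (L ^+ k) L = 0.
Proof. by rewrite /comm -exprS -exprSr subrr. Qed.

End Abstract.

Local Notation A := (freealg F (n + n)).
Local Notation ell := (linform (fun i => 'X_i : {mpoly F[n + n]})).
Local Notation ellA := (linform (@gen F (n + n) : 'I_(n + n) -> A)).

(** The conditions are compatible with linear combinations of pairs (h, D), so such lifts can be
    assembled from those of powers of linear forms. *)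
Definition hamiltonian_lift (h : {mpoly F[n + n]}) (D : der A) : Prop :=
  der_fun D (omega F n) = 0 /\
  forall i, feigin_shoikhet (der_fun D (gen F (lshift n i))) =
      form0 (h^`M(rshift n i)) /\
    feigin_shoikhet (der_fun D (gen F (rshift n i))) =
      form0 (- h^`M(lshift n i)).

(* For h = l^k the derivation sends each generator to a multiple of l^(k-1),
   so that omega goes to a multiple of [l^(k-1), l] = 0. *)
Lemma hamiltonian_lift_linform c k : exists D, hamiltonian_lift (ell c ^+ k) D.
Proof.
have fsZ a (b : A) : @feigin_shoikhet F _ (a *: b) = a *: feigin_shoikhet b.
  have fs0 : @feigin_shoikhet F (n + n) 0 = 0.
    have := feigin_shoikhet_linear (- 1) (0 : A) 0.
    by rewrite scaler0 addr0 scaleN1r addNr.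
  have := feigin_shoikhet_linear a b 0; rewrite fs0 !addr0; exact.
(* For [k = 0] this factor vanishes, which makes the truncated exponent [k.-1] harmless. *)
pose a : F := k%:R.
pose u j := match fintype.split j with
  | inl i => (a * c (rshift n i)) *: ellA c ^+ k.-1
  | inr i => (- (a * c (lshift n i))) *: ellA c ^+ k.-1 end.
have ul i : u (lshift n i) = (a * c (rshift n i)) *: ellA c ^+ k.-1.
  by rewrite /u (unsplitK (inl i : _ + _)%type).
have ur i : u (rshift n i) = - (a * c (lshift n i)) *: ellA c ^+ k.-1.
  by rewrite /u (unsplitK (inr i : _ + _)%type).
have dE j : (ell c ^+ k)^`M(j) = (a * c j) *: ell c ^+ k.-1.
  rewrite /a; case: k {a u ul ur} => [|k]; last exact: mderiv_linform_exp.
  by rewrite expr0 -mpolyC1 mderivC mul0r scale0r.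
exists (free_der u); split=> [|i].
  apply: etrans (der_sum_comm _ _) _.
  pose s := sum_comm_linform (c := fun j => a * c j) (@gen F (n + n) : _ -> A) ul ur.
  apply: etrans (congr1 (GRing.scale _) (etrans _ s)) _.
    by apply: eq_bigr => i _; rewrite !free_der_gen.
  have -> : linform (@gen F (n + n) : 'I_(n + n) -> A) (fun i => a * c i) = a *: ellA c.
    by rewrite /linform scaler_sumr; apply: eq_bigr => j _; rewrite scalerA.
  rewrite -[a *: _]addr0 comm_linearr comm_exp scaler0 add0r /comm mulr0 mul0r.
  by rewrite subrr scaler0.
split; rewrite free_der_gen dE ?(ul, ur) -?scaleNr form0Z;
  by apply: etrans (fsZ _ _) _; rewrite feigin_shoikhet_linform_exp.
Qed.

Lemma hamiltonian_lift_exists h : exists D, hamiltonian_lift h D.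
Proof.
have /lspanP := linform_powers_span char0 h.
elim=> [|a _ p [c [k ->]] _ [E [Eo EE]]].
  (* The power with exponent 0 is the constant 1, whose derivatives are those of the potential 0. *)
  have [D [Do DE]] := hamiltonian_lift_linform (fun=> 0) 0.
  exists D; split=> // i; have [-> ->] := DE i.
  by rewrite expr0 -mpolyC1 !mderivC ?mderiv0.
have [D [Do DE]] := hamiltonian_lift_linform c k.
exists (a *: D + E); split=> [|i].
  by apply: etrans (_ : a *: der_fun D (omega F n) + der_fun E (omega F n) = 0) => //;
    rewrite Do Eo scaler0 addr0.
have [Dl Dr] := DE i; have [El Er] := EE i.
split.
  apply: etrans (feigin_shoikhet_linear a _ _) _.
  by rewrite Dl El linearP form0D form0Z.
apply: etrans (feigin_shoikhet_linear a _ _) _.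
by rewrite Dr Er linearP opprD form0D -scalerN form0Z.
Qed.

End HamiltonianLifts.

(** * The Poincare lemma for polynomial one-forms *)

Section Poincare.
Variables (F : fieldType) (m : nat).
Hypothesis char0 : forall k, k.+1%:R != 0 :> F.

(** Monomials are eigenvectors of the operator x_i d/dx_i. *)
Lemma mcoeff_mulX_mderiv i (p : {mpoly F[m]}) a :
  ('X_i * p^`M(i))@_a = p@_a *+ a i.
Proof.
elim/mpolyind: p => [|c b p _ _ IH].
  by rewrite mderiv0 mulr0 mcoeff0 mul0rn.
rewrite linearP mulrDr mcoeffD IH mcoeffD mulrnDl; congr (_ + _).
rewrite -scalerAr !mcoeffZ mcoeffX -mulrnAr; congr (_ * _).
rewrite /= mderivX -scalerAr mcoeffZ -mpolyXD mcoeffX.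
case bi: (b i) => [|k].
  by rewrite mul0r; case: eqP => [<-|_]; rewrite ?bi ?mul0rn.
rewrite addmC submK; last first.
  by apply/mnm_lepP => j; rewrite mnm1E; case: eqP => // <-; rewrite bi.
by case: eqP => [<-|_]; rewrite ?mulr0 ?mul0rn // bi mulr1.
Qed.

(** The radial primitive: for p = sum_j x_j th_j, closedness and Euler's formula show that the
    derivative of p along x_i multiplies the degree d part of th_i by d + 1. Dividing each
    coefficient of p by its degree therefore gives h. *)
Lemma poincare (th : 'I_m -> {mpoly F[m]}) :
  (forall i j, (th j)^`M(i) = (th i)^`M(j)) ->
  exists h : {mpoly F[m]}, forall i, h^`M(i) = th i.
Proof.
move=> th_closed; pose p : {mpoly F[m]} := \sum_j 'X_j * th j.
(* In degree 0 the division returns 0; the derivatives of [h] involve only positive degrees. *)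
pose h := \sum_(a <- msupp p) (p@_a / (mdeg a)%:R) *: 'X_[a].
have hE a : h@_a = p@_a / (mdeg a)%:R.
  rewrite /h raddf_sum /=; case: (boolP (a \in msupp p)) => [ap|].
    rewrite (bigD1_seq a) //= big1 => [|b /negPf ne].
      by rewrite mcoeffZ mcoeffX eqxx mulr1 addr0.
    by rewrite mcoeffZ mcoeffX ne mulr0.
  rewrite -mcoeff_eq0 => /eqP pa0; rewrite pa0 mul0r big1_seq // => b /andP[_ bp].
  rewrite mcoeffZ mcoeffX; case: eqP => [ba|_]; last by rewrite mulr0.
  by rewrite ba pa0 !mul0r.
have dpE i a : (p^`M(i))@_a = (mdeg a).+1%:R * (th i)@_a.
  have -> : p^`M(i) = \sum_j ('X_j * th j)^`M(i) by exact: linear_sum.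
  under eq_bigr do rewrite mderivM.
  rewrite big_split /=.
  rewrite mcoeffD (bigD1 i) //= mderivXU eqxx mul1r big1 ?addr0 => [|j ne_ji].
    under eq_bigr do rewrite th_closed.
    rewrite raddf_sum /=; under eq_bigr do rewrite mcoeff_mulX_mderiv.
    by rewrite sumrMnr -mdegE mulr_natl mulrS.
  by rewrite mderivXU (negPf ne_ji) mul0r.
exists h => i; apply/mpolyP => a; rewrite mcoeff_deriv hE.
have := dpE i a; rewrite mcoeff_deriv mdegD mdeg1 addn1 => e.
apply: (mulfI (char0 (mdeg a))); rewrite -e mulrnAr mulrC -mulrA mulVf ?mulr1 //.
Qed.

End Poincare.

(** * Potentials of Hamiltonian fields *)

Section HamiltonianFields.
Variables (F : fieldType) (n : nat).
Hypothesis char0 : forall k, k.+1%:R != 0 :> F.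
Local Notation P := {mpoly F[n + n]}.

Lemma omega_formE S :
  omega_form F n S = \sum_(i < n) (S == [set lshift n i; rshift n i])%:R.
Proof.
rewrite /omega_form sum_ffunE; apply: eq_bigr => i _.
rewrite wedge_dvar; case: ifPn => [lS|lS]; last first.
  case: eqP => // SE; by rewrite SE !inE eqxx in lS.
rewrite ffunE; case: eqP => [SE|ne].
  rewrite SE inversions_set11 /= ltnNge (leq_trans (ltnW (ltn_ord i))) ?leq_addr //.
  by rewrite mul1r -(setD1K lS) SE eqxx.
rewrite mulr0; case: eqP => // SE; case: ne; apply/setP => k.
rewrite SE !inE; case: eqP => // ->.
by rewrite eq_lrshift.
Qed.

Lemma contract_set1 m (v : der {mpoly F[m]}) al j : contract v al [set j] =
  \sum_(k | k != j) (-1) ^+ (j < k)%N * der_fun v 'X_k * al [set k; j].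
Proof.
rewrite ffunE; apply: eq_big => k; first by rewrite inE.
by rewrite inversions_set11.
Qed.

Lemma omega_form_set2 (i : 'I_n) (j k : 'I_(n + n)) : k != j ->
  j = lshift n i \/ j = rshift n i ->
  omega_form F n [set k; j] = ([set k; j] == [set lshift n i; rshift n i])%:R.
Proof.
move=> ne ji; rewrite omega_formE (bigD1 i) //= big1 ?addr0 // => i' ne_i.
case: eqP => // SE; have : j \in [set k; j] by rewrite !inE eqxx orbT.
rewrite SE !inE; case: ji => ->.
  by rewrite eq_lrshift orbF eq_lshift eq_sym (negPf ne_i).
by rewrite eq_rlshift eq_rshift eq_sym (negPf ne_i).
Qed.

Variable v : der P.
Let th j := contract v (omega_form F n) [set j].

(** This lemma and the next one read off the coefficients of the contraction sum_i (v_i dx_(i+n) -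
    v_(i+n) dx_i). *)
Lemma contract_omega_rshift i : th (rshift n i) = der_fun v 'X_(lshift n i).
Proof.
rewrite /th contract_set1 (bigD1 (lshift n i)) ?eq_lrshift //= big1 ?addr0.
  rewrite (@omega_form_set2 i) ?eq_lrshift //; last by right.
  rewrite eqxx mulr1 ltnNge (leq_trans (ltnW (ltn_ord i))) ?leq_addr //.
  by rewrite mul1r.
move=> k /andP[kr kl]; rewrite (@omega_form_set2 i) //; last by right.
case: eqP => [SE|]; last by rewrite mulr0.
have : k \in [set k; rshift n i] by rewrite !inE eqxx.
by rewrite SE !inE (negPf kr) (negPf kl).
Qed.

Lemma contract_omega_lshift i : th (lshift n i) = - der_fun v 'X_(rshift n i).
Proof.
rewrite /th contract_set1 (bigD1 (rshift n i)) ?eq_rlshift //= big1 ?addr0.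
  rewrite (@omega_form_set2 i) ?eq_rlshift //; last by left.
  rewrite setUC eqxx mulr1 (leq_trans (ltn_ord i)) ?leq_addr //.
  by rewrite mulN1r.
move=> k /andP[kl kr]; rewrite (@omega_form_set2 i) //; last by left.
case: eqP => [SE|]; last by rewrite mulr0.
have : k \in [set k; lshift n i] by rewrite !inE eqxx.
by rewrite SE !inE (negPf kr) (negPf kl).
Qed.

Lemma dform_set2 m (al : Defs.form F m) i j : i != j ->
  dform al [set i; j] = (-1) ^+ (j < i)%N * ((al [set j])^`M(i) - (al [set i])^`M(j)).
Proof.
move=> ne; rewrite /dform sum_ffunE (bigD1 i) //= (bigD1 j) 1?eq_sym //=.
have set2D1 (a b : 'I_m) : a != b -> [set a; b] :\ a = [set b].
  move=> nab; apply/setP => k; rewrite !inE; case: eqP => [->|_] //=.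
  by rewrite (negPf nab).
rewrite big1 ?addr0 => [|k /andP[ki kj]]; last first.
  by rewrite wedge_dvar !inE (negPf ki) (negPf kj).
rewrite !wedge_dvar !inE !eqxx orbT set2D1 // [in X in _ + X]setUC set2D1 1?eq_sym //.
rewrite !inversions_set11 !ffunE mulrBr; congr (_ + _).
case: (ltngtP i j) => [||/val_inj eij]; rewrite ?mulN1r ?mul1r ?opprK //.
by rewrite eij eqxx in ne.
Qed.

Lemma dform_omega : dform (omega_form F n) = 0.
Proof.
rewrite /dform big1 // => i _; apply/ffunP => S; rewrite wedge_dvar.
suff dO T : (omega_form F n T)^`M(i) = 0.
  by rewrite ffunE dO mulr0 if_same ffunE.
rewrite omega_formE linear_sum big1 // => j _ /=.
by case: eqP => _; rewrite ?mderiv0 // -mpolyC1 mderivC.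
Qed.

(** Since omega is closed, the Lie derivative is the differential of the contraction [th]. For a
    Hamiltonian field that one-form is closed, and [poincare] provides its potential. *)
Lemma hamiltonian_potential : hamiltonian v -> exists h : P, forall i,
  der_fun v 'X_(lshift n i) = h^`M(rshift n i) /\
  der_fun v 'X_(rshift n i) = - h^`M(lshift n i).
Proof.
rewrite /hamiltonian /lie_derivative dform_omega.
have -> : contract v (0 : Defs.form F (n + n)) = 0.
  by apply/ffunP => S; rewrite !ffunE big1 // => i _; rewrite ffunE mulr0.
rewrite addr0 => d0.
have [i j|h hE] := @poincare _ _ char0 th.
  have [->|ne] := eqVneq i j; first by [].
  have : dform (contract v (omega_form F n)) [set i; j] = 0 by rewrite d0 ffunE.
  rewrite dform_set2 // => /eqP; rewrite mulf_eq0 signr_eq0 subr_eq0 => /eqP.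
  exact.
by exists h => i; rewrite !hE contract_omega_rshift contract_omega_lshift opprK.
Qed.

(** By [omega_sub_der] such a lift preserves the ideal of omega, a property that the definition of
    [lift_der v] does not provide. *)
Lemma hamiltonian_lift_der : hamiltonian v ->
  exists2 D : der (freealg F (n + n)), der_fun D (omega F n) = 0 & lifts v D.
Proof.
case/hamiltonian_potential => h hE.
have [D [Do DE]] := hamiltonian_lift_exists char0 h.
exists D => // j; case: (split_ordP j) => i ->.
  by have [-> _] := hE i; have [-> _] := DE i.
by have [_ ->] := hE i; have [_ ->] := DE i.
Qed.

Fact derM_mid (R : algType F) (D : der R) a s b : der_fun D s = 0 ->
  der_fun D (a * s * b) = der_fun D a * s * b + a * s * der_fun D b.
Proof. by move=> Ds; rewrite !derM Ds mulr0 addr0. Qed.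

Lemma omega_sub_der (D : der (freealg F (n + n))) : der_fun D (omega F n) = 0 ->
  forall x, x \in omega_sub F n -> der_fun D x \in omega_sub F n.
Proof.
move=> Do; apply: lspan_homo => [|_ [a [s [b [-> ->]]]]]; first exact: der_linear.
rewrite (derM_mid _ _ Do).
by apply: rpredD; apply: mem_lspan; [exists (der_fun D a), (omega F n), b
  | exists a, (omega F n), (der_fun D b)].
Qed.

End HamiltonianFields.

(** * Values of combinations and brackets of derivations *)

Section PointwiseDerivations.
Variables (F : fieldType) (R : algType F).
Implicit Types (D E : der R) (x : R).

Lemma der_fun_linear c D E x : der_fun (c *: D + E) x = c *: der_fun D x + der_fun E x.
Proof. by []. Qed.

Lemma der_fun_sub D E x : der_fun (D - E) x = der_fun D x - der_fun E x.
Proof. by []. Qed.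

Lemma der_fun_bracket D E x : der_fun (der_bracket D E) x =
  der_fun D (der_fun E x) - der_fun E (der_fun D x).
Proof. by []. Qed.

End PointwiseDerivations.

(** * Linearity and bracket compatibility of lifts modulo M_3 *)

Section LiftsModuloMser3.
Variables (F : fieldType) (m : nat).
Hypothesis char0 : forall k, k.+1%:R != 0 :> F.
Local Notation A := (freealg F m).
Local Notation P := {mpoly F[m]}.
Local Notation sym := (symm (char0 1) (@quot3_comm F m) (@gen3 F m)).

Section InducedDerivation.
Variable D : der A.

Definition der_quot3 (b : quot3 F m) : quot3 F m := proj3 (der_fun D (qrep b)).

Lemma der_sub a b : der_fun D (a - b) = der_fun D a - der_fun D b.
Proof. by rewrite addrC -scaleN1r der_linear scaleN1r addrC. Qed.

(** The representative is irrelevant because every derivation preserves M_3. *)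
Lemma der_quot3E a : der_quot3 (proj3 a) = proj3 (der_fun D a).
Proof.
apply/proj3_eq; rewrite -der_sub; apply: der_Mser; apply/proj3_eq.
exact: qrepK.
Qed.

Lemma der_quot3_linear : linear der_quot3.
Proof.
move=> c x y; have [a <-] := proj3_surj x; have [b <-] := proj3_surj y.
apply: etrans (congr1 der_quot3 (esym (proj3_linear c a b))) _.
apply: etrans (der_quot3E _) (etrans (congr1 _ (der_linear D c a b)) _).
apply: etrans (proj3_linear _ _ _) _.
exact: (congr2 (fun u v => c *: u + v) (esym (der_quot3E a)) (esym (der_quot3E b))).
Qed.

Lemma der_quot3M x y : der_quot3 (x * y) = der_quot3 x * y + x * der_quot3 y.
Proof.
have [a <-] := proj3_surj x; have [b <-] := proj3_surj y.
rewrite -(proj3M a b) (der_quot3E (a * b)) (der_quot3E a) (der_quot3E b).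
rewrite (derM D a b) -(proj3M (der_fun D a)) -(proj3M a); exact: aclsD.
Qed.

(* Both sides are derivations along the algebra morphism [sym] to the Jordan
   algebra of A / M_3, and they agree on the variables. *)
Lemma lifts_symm (v : der P) : lifts v D ->
  forall p, der_quot3 (sym p) = sym (der_fun v p).
Proof.
move=> vD.
pose J := jordan (char0 1) (@quot3_comm F m).
pose d p : J := der_quot3 (sym p); pose e p : J := sym (der_fun v p).
have ld : linear d.
  by move=> c p q; rewrite /d (symm_linear _ _ _ c p q); apply: der_quot3_linear.
have le : linear e by move=> c p q; rewrite /e der_linear symm_linear.
have dM p q : d (p * q) = d p * sym q + sym p * d q.
  rewrite /d (symmM _ _ _ p q).
  exact: (der_jordan der_quot3_linear der_quot3M (sym p) (sym q)).
have eM p q : e (p * q) = e p * sym q + sym p * e q.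
  by rewrite /e derM symmD !symmM.
apply: (symm_der_uniq ld le dM eM) => i; rewrite /d /e symmX.
by apply: etrans (der_quot3E _) _; apply: feigin_shoikhet_function.
Qed.

End InducedDerivation.

(** The condition on [E] is stated in A / M_3, where it can be checked for combinations and brackets
    of lifts as well as for lifts. *)
Lemma lifts_sub_small (v : der P) (D E : der A) : lifts v D ->
  (forall i, proj3 (der_fun E (gen F i)) = sym (der_fun v 'X_i)) ->
  forall a, der_fun (D - E) a \in Mser A 3.
Proof.
move=> vD vE; apply: small_der_gen => i; apply/proj3_eq.
by rewrite vE; apply: (feigin_shoikhet_function (char0 1) (vD i)).
Qed.

Lemma lift_der_linear a (v w : der P) x :
  der_fun (lift_der (a *: v + w) - (a *: lift_der v + lift_der w)) x \in Mser A 3.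
Proof.
apply: lifts_sub_small; first exact: lift_derP.
move=> i; apply: etrans (proj3_linear a _ _) _.
rewrite !(feigin_shoikhet_function (char0 1) (lift_derP char0 _ i)).
exact: (esym (symm_linear _ _ _ a _ _)).
Qed.

(** Modulo M_3 one lift sends a generator to [sym] of a polynomial, and [lifts_symm] evaluates the
    other lift there. *)
Lemma lift_der_bracket (v w : der P) x :
  der_fun (lift_der (der_bracket v w) -
    der_bracket (lift_der v) (lift_der w)) x \in Mser A 3.
Proof.
apply: lifts_sub_small; first exact: lift_derP.
have e (u u' : der P) i : proj3 (der_fun (lift_der u) (der_fun (lift_der u') (gen F i)))
    = sym (der_fun u (der_fun u' 'X_i)).
  rewrite -der_quot3E (feigin_shoikhet_function (char0 1) (lift_derP char0 _ i)).
  exact: (lifts_symm (lift_derP char0 u)).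
move=> i.
have -> : der_fun (der_bracket (lift_der v) (lift_der w)) (gen F i) =
    -1 *: der_fun (lift_der w) (der_fun (lift_der v) (gen F i)) +
    der_fun (lift_der v) (der_fun (lift_der w) (gen F i)).
  by rewrite scaleN1r addrC.
rewrite proj3_linear !e -symm_linear scaleN1r addrC.
by [].
Qed.

End LiftsModuloMser3.

(** * Linearity in subquotients *)

(** Allowing any [z] congruent to the combination modulo [W] reduces the rules of a Lie action to
    the smallness of a difference of derivations. *)
Lemma subcls_linear (F : fieldType) (V : lmodType F) (U W : lsubspace V) c x y z (Ux : x \in U) (Uy : y \in U)
    (Uz : z \in U) :
  z - (c *: x + y) \in W -> subcls W Uz = c *: subcls W Ux + subcls W Uy.
Proof.
move=> Wz; rewrite /subcls -qcls_linear; apply/qcls_eq.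
by rewrite unfold_in /restr raddfB linearP /= scalerN -opprD.
Qed.

Lemma subquo_map_linear (F : fieldType) (V V' : lmodType F) (U W : lsubspace V) (U' W' : lsubspace V') (f : V -> V')
    (fU : forall x, x \in U -> f x \in U') :
  linear f -> (forall x, x \in W -> f x \in W') -> linear (subquo_map W' fU (W := W)).
Proof.
move=> lf fW c y z; have -> : c *: y + z =
    subcls W (rpredD (rpredZ c (subrepP y)) (subrepP z)).
  rewrite -[y in LHS]subrepK -[z in LHS]subrepK; apply: esym; apply: subcls_linear.
  by rewrite subrr rpred0.
rewrite subquo_mapE // /subquo_map; apply: subcls_linear.
by rewrite lf subrr rpred0.
Qed.

(** * Descent for an abstract subquotient, covering B_k and N_k at once *)

Section Descent.
Variables (F : fieldType) (n : nat).
Hypothesis char0 : forall k, k.+1%:R != 0 :> F.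
Local Notation A := (freealg F (n + n)).
Local Notation A' := (freealg_omega F n).
Local Notation P := {mpoly F[n + n]}.
Variables (U W : lsubspace A) (U' W' : lsubspace A').
Hypothesis dU : forall (D : der A) x, x \in U -> der_fun D x \in U.
Hypothesis dW : forall (D : der A) x, x \in W -> der_fun D x \in W.
Hypothesis small_der : forall D : der A, (forall a, der_fun D a \in Mser A 3) ->
  forall x, x \in U -> der_fun D x \in W.
Hypothesis pU : forall x, x \in U -> projA x \in U'.
Hypothesis pW : forall x, x \in W -> projA x \in W'.
Hypothesis sU : forall y, y \in U' -> exists2 x, x \in U & y = projA x.
Hypothesis sW : forall y, y \in W' -> exists2 x, x \in W & y = projA x.

(** In the two instances, [act] and [pr] are convertible to [actB] and [projB], resp. [actN] and
    [projN]. *)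
Let act (v : der P) : subquo U W -> subquo U W := subquo_map W (@dU (lift_der v)).
Let pr : subquo U W -> subquo U' W' := subquo_map W' pU.

Let actE v x (Ux : x \in U) : act v (subcls W Ux) = subcls W (dU (lift_der v) Ux).
Proof. by apply: subquo_mapE; [exact: der_linear | exact: dW]. Qed.

Let prE x (Ux : x \in U) : pr (subcls W Ux) = subcls W' (pU Ux).
Proof. by apply: subquo_mapE; [exact: projA_linear | exact: pW]. Qed.

Let act_linear v : linear (act v).
Proof. by apply: subquo_map_linear; [exact: der_linear | exact: dW]. Qed.

Let pr_linear : linear pr.
Proof. by apply: subquo_map_linear; [exact: projA_linear | exact: pW]. Qed.

Let act_der_linear a v w b : act (a *: v + w) b = a *: act v b + act w b.
Proof.
rewrite -[b]subrepK !actE; apply: subcls_linear.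
rewrite -der_fun_linear -der_fun_sub.
exact: (small_der (lift_der_linear char0 a v w) (subrepP b)).
Qed.

Let act_bracket v w b :
  act (der_bracket v w) b = act v (act w b) - act w (act v b).
Proof.
rewrite -[b]subrepK !actE addrC -scaleN1r; apply: subcls_linear.
rewrite scaleN1r [X in _ - X]addrC -der_fun_bracket -der_fun_sub.
exact: (small_der (lift_der_bracket char0 v w) (subrepP b)).
Qed.

Let projA_sub x y : projA (x - y) = projA x - projA y :> A'.
Proof. by rewrite addrC -scaleN1r projA_linear scaleN1r addrC. Qed.

(** Let E be a lift of v killing omega, and D the chosen lift. If x - x' agrees with some w in [W]
    modulo the ideal of omega, which E preserves, then D (x - x') agrees with (D - E) (x - x') + E w
    modulo that ideal; the first term is in [W] by smallness of D - E, the second because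
    derivations preserve [W]. *)
Let pr_act_compat v b b' : hamiltonian v -> pr b = pr b' ->
  pr (act v b) = pr (act v b').
Proof.
move=> /(hamiltonian_lift_der char0) [E Eo vE].
rewrite -[b]subrepK -[b']subrepK !actE !prE => /subcls_eq.
move: (subrep b) (subrep b') (subrepP b) (subrepP b') => x x' Ux Ux'.
rewrite -projA_sub => /sW[w Ww we]; apply/subcls_eq; rewrite -projA_sub -der_sub.
set D := lift_der v.
have Uxx : x - x' \in U by apply: rpredB.
have Wz : der_fun (D - E) (x - x') + der_fun E w \in W.
  apply: rpredD; last exact: dW.
  apply: small_der Uxx; apply: lifts_sub_small; first exact: lift_derP.
  by move=> i; apply: feigin_shoikhet_function.
have -> : projA (der_fun D (x - x')) =
    projA (der_fun (D - E) (x - x') + der_fun E w) :> A'.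
  apply/qcls_eq.
  have -> : der_fun D (x - x') - (der_fun (D - E) (x - x') + der_fun E w) =
      der_fun E (x - x' - w).
    by rewrite der_fun_sub opprD opprB addrA addrCA subrr addr0 -der_sub.
  apply: (omega_sub_der Eo); exact/qcls_eq.
exact: pW.
Qed.

(** The action is transported along an arbitrary section [s] of [pr]; by [pr_act_compat] its choice
    does not affect the operators of Hamiltonian fields. *)
Lemma descent : exists rho : der P -> subquo U' W' -> subquo U' W',
  lie_action (@hamiltonian F n) rho /\
  forall v, hamiltonian v -> forall b, pr (act v b) = rho v (pr b).
Proof.
have pr_surj z : exists b, pr b = z.
  by apply: subquo_map_surj; [exact: projA_linear | exact: pW | exact: sU].
have [s sE] := choice pr_surj.
have compat v : hamiltonian v -> forall b, pr (act v (s (pr b))) = pr (act v b).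
  by move=> hv b; apply: pr_act_compat.
exists (fun v z => pr (act v (s z))); split=> [|v hv b]; last by rewrite compat.
split=> [v hv c z z'|a v w _ _ z|v w hv hw z].
- have -> : c *: z + z' = pr (c *: s z + s z') by rewrite pr_linear !sE.
  by rewrite compat // act_linear pr_linear.
- by rewrite act_der_linear pr_linear.
have pr_sub b b' : pr (b - b') = pr b - pr b'.
  by rewrite addrC -scaleN1r pr_linear scaleN1r addrC.
by rewrite !compat // act_bracket pr_sub.
Qed.

End Descent.

(** * The instances B_k and N_k *)

Section DescentToQuotients.
Variables (F : fieldType) (n : nat).
Hypothesis char0 : forall k, k.+1%:R != 0 :> F.
Local Notation A' := (freealg_omega F n).
Let pl := @projA_linear F n.
Let pM := @projAM F n.
Let ps := @projA_surj F n.

Lemma descentB k : (2 <= k)%N ->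
  exists rho : der {mpoly F[n + n]} -> Bquo A' k -> Bquo A' k,
    lie_action (@hamiltonian F n) rho /\
    forall v, hamiltonian v -> forall b, projB (actB v b) = rho v (projB b).
Proof.
move=> hk; exact: (descent char0
  (fun D => @der_Lser _ _ D k) (fun D => @der_Lser _ _ D k.+1)
  (fun D sD x => @small_der_Lser _ _ D sD k x hk)
  (@Lser_homo _ _ _ _ pl pM k) (@Lser_homo _ _ _ _ pl pM k.+1)
  (@Lser_surj _ _ _ _ pl pM ps k) (@Lser_surj _ _ _ _ pl pM ps k.+1)).
Qed.

Lemma descentN k : (1 <= k)%N ->
  exists rho : der {mpoly F[n + n]} -> Nquo A' k -> Nquo A' k,
    lie_action (@hamiltonian F n) rho /\
    forall v, hamiltonian v -> forall b, projN (actN v b) = rho v (projN b).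
Proof.
move=> hk; exact: (descent char0
  (fun D => @der_Mser _ _ D k) (fun D => @der_Mser _ _ D k.+1)
  (fun D sD x => @small_der_Mser _ _ D sD k x hk)
  (@Mser_homo _ _ _ _ pl pM k) (@Mser_homo _ _ _ _ pl pM k.+1)
  (@Mser_surj _ _ _ _ pl pM ps k) (@Mser_surj _ _ _ _ pl pM ps k.+1)).
Qed.

End DescentToQuotients.

Theorem proposition3p2 (R : realType) (n : nat) (hn : (0 < n)%N) :
  (forall k : nat, (2 <= k)%N ->
     exists rho : der {mpoly R[i][n + n]} ->
         Bquo (freealg_omega R[i] n) k -> Bquo (freealg_omega R[i] n) k,
       lie_action (@hamiltonian R[i] n) rho /\
       forall v, hamiltonian v ->
         forall b, projB (actB v b) = rho v (projB b)) /\
  (forall k : nat, (1 <= k)%N ->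
     exists rho : der {mpoly R[i][n + n]} ->
         Nquo (freealg_omega R[i] n) k -> Nquo (freealg_omega R[i] n) k,
       lie_action (@hamiltonian R[i] n) rho /\
       forall v, hamiltonian v ->
         forall b, projN (actN v b) = rho v (projN b)).
Proof.
have char0 k : k.+1%:R != 0 :> R[i] by rewrite Num.Theory.pnatr_eq0.
by split=> k; [exact: descentB | exact: descentN].
Qed.
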